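(* Two-memory stochastic strategies (with both randomized next moves and stochastic memory update) are sufficient for $\mathsf{MDP}^{\{\mathbb{E},\mathrm{VaR},\mathrm{CVaR}\}}_{\mathsf{r},\mathsf{multi}}$. Moreover, if $\mathbf{r}_j(s)\ge0$ for all $s\in T$ and $j\in[d]$, then memoryless randomizing strategies are sufficient.
   Context: An MDP $\mathcal{M}=(S,\mathsf{A},\mathsf{Av},\Delta,s_0)$: finite states and actions, $\mathsf{Av}(s)\neq\emptyset$ partitioning $\mathsf{A}$, $\Delta:\mathsf{A}\to\mathcal{D}(S)$, initial state $s_0$. A strategy $\sigma=(\sigma_u,\sigma_n,\alpha)$ over countable memory $\mathsf{M}$ ($\sigma_u:\mathsf{A}\times S\times\mathsf{M}\to\mathcal{D}(\mathsf{M})$, $\sigma_n:S\times\mathsf{M}\to\mathcal{D}(\mathsf{A})$, $\alpha\in\mathcal{D}(\mathsf{M})$) induces $\mathbb{P}^\sigma$ on runs; two-memory: $|\mathsf{M}|=2$; memoryless: $|\mathsf{M}|=1$. Weighted reachability: absorbing target set $T$, $\mathbf{r}:T\to\mathbb{Q}^d$, $X(\rho)$ = reward vector of first visited target state or $0$ if none. A query: $\mathbf{e},\mathbf{c},\mathbf{v}\in(\mathbb{Q}\cup\{\bot\})^d$, $\mathbf{p},\mathbf{q}\in(0,1)^d$; $\sigma$ satisfies it iff for all $j\in[d]$, $\mathbb{E}^\sigma[X_j]\ge\mathbf{e}_j$, $\mathrm{CVaR}^\sigma_{\mathbf{p}_j}(X_j)\ge\mathbf{c}_j$, $\mathrm{VaR}^\sigma_{\mathbf{q}_j}(X_j)\ge\mathbf{v}_j$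 ($\bot$ trivially satisfied). ''Sufficient'' means: if some strategy satisfies the query then one of the stated class does. $\mathrm{VaR}_p(Y)=\sup\{r\mid F_Y(r)\le p\}$; with $v=\mathrm{VaR}_p(Y)$, $\mathrm{CVaR}_p(Y)=\frac1p\big(\int_{(-\infty,v)}x\,dF_Y+(p-\mathbb{P}[Y<v])v\big)$. *)

(* Defs.v *)
From HB Require Import structures.
From mathcomp Require Import all_boot all_order all_algebra.
From mathcomp Require Import all_classical all_reals all_analysis.

Set Implicit Arguments.
Unset Strict Implicit.
Unset Printing Implicit Defensive.

Import Order.TTheory GRing.Theory Num.Theory.
Import numFieldNormedType.Exports.

Local Open Scope classical_set_scope.
Local Open Scope ring_scope.

Record distr (R : realType) (X : choiceType) := Distr {
  dprob :> X -> R;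
  dprob_ge0 : forall x, 0 <= dprob x;
  dprob_sum1 : (\esum_(x in [set: X]) (dprob x)%:E = 1)%E
}.

(** [Av] is an indexed partition: [finset.partition] makes the distinct sets [Av s]
    nonempty, pairwise disjoint and covering, and injectivity forbids two states
    from sharing their set of actions. *)
Record mdp (R : realType) := Mdp {
  state : finType;
  action : finType;
  Av : state -> {set action};
  Av_inj : injective Av;
  Av_partition : finset.partition [set Av s | s in state] [set: action]%SET;
  trans : action -> distr R state;
  init : state
}.

Record strategy (R : realType) (M : mdp R) (Mem : countType) := Strategy {
  mem_update : action M -> state M -> Mem -> distr R Mem;
  next_move : state M -> Mem -> distr R (action M);
  init_mem : distr R Mem;
  next_move_Av : forall s m a, 0 < next_move s m a -> a \in Av s
}.

Section Runs.
Context (R : realType) (M : mdp R).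

(** Infinite sequences of state-action pairs. The conditions [a_i \in Av s_i]
    and [trans a_i s_(i+1) > 0] are not imposed on the type: they hold almost
    surely under every measure induced by a strategy. *)
Definition run_seq : Type := nat -> state M * action M.

Lemma Av_neq0 (s : state M) : exists a, a \in Av s.
Proof.
have /and3P[_ _ h0] := Av_partition M.
apply/set0Pn; apply: contra h0 => /eqP <-.
by apply/imsetP; exists s.
Qed.

HB.instance Definition _ := gen_eqMixin run_seq.
HB.instance Definition _ := gen_choiceMixin run_seq.
HB.instance Definition _ :=
  isPointed.Build run_seq (fun=> (init M, xchoose (Av_neq0 (init M)))).

Definition cylinder (rho : run_seq) (n : nat) : set run_seq :=
  [set rho' | forall i, (i <= n)%N -> rho' i = rho i].

Definition cylinders : set (set run_seq) :=
  [set C | exists rho n, C = cylinder rho n].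

Definition run := g_sigma_algebraType cylinders.

End Runs.

Section InducedMeasure.
Context (R : realType) (M : mdp R) (Mem : countType) (sigma : strategy M Mem).

(** The Markov chain on [state M * Mem * action M] determined by [sigma]. *)
Definition chain_init (x : state M * Mem * action M) : R :=
  let: (s, m, a) := x in
  (s == init M)%:R * init_mem sigma m * next_move sigma s m a.

Definition chain_step (x x' : state M * Mem * action M) : R :=
  let: (s, m, a) := x in
  let: (s', m', a') := x' in
  trans a s' * mem_update sigma a s' m m' * next_move sigma s' m' a'.

(** Probability that the chain visits the state-action pairs of [rho] at times
    [0, ..., n] and has memory [m] at time [n]. *)
Fixpoint prefix_prob (rho : run M) (n : nat) (m : Mem) : \bar R :=
  match n with
  | 0 => (chain_init ((rho 0%N).1, m, (rho 0%N).2))%:E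
  | n'.+1 =>
      (\esum_(m' in [set: Mem])
         (prefix_prob rho n' m' *
          (chain_step ((rho n').1, m', (rho n').2)
                      ((rho n).1, m, (rho n).2))%:E))%E
  end.

(** The law of the state-action components of the chain; at most one [P]
    satisfies this, since the cylinders and [set0] form a pi-system. *)
Definition induced_measure (P : probability (run M) R) : Prop :=
  forall (rho : run M) (n : nat),
    P (cylinder rho n) = (\esum_(m in [set: Mem]) prefix_prob rho n m)%E.

End InducedMeasure.

Section WeightedReachability.
Context (R : realType) (M : mdp R) (T : {set state M}) (d : nat).

Definition absorbing : Prop :=
  forall s a, s \in T -> a \in Av s -> trans a s = 1.

(** Only the values of [r] on [T] matter. *)
Context (r : state M -> 'I_d -> rat).

Definition reward (j : 'I_d) (rho : run M) : R :=
  if pselect (exists n, (rho n).1 \in T) is left hit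
  then ratr (r (rho (ex_minn hit)).1 j) else 0.

Lemma measurable_prefix (n : nat) (A : set (run M)) :
  (forall rho rho' : run M, (forall i, (i <= n)%N -> rho i = rho' i) ->
     A rho -> A rho') ->
  measurable A.
Proof.
move=> hA.
pose ext (w : {ffun 'I_n.+1 -> state M * action M}) : run M :=
  fun i => w (inord i).
have -> : A = \bigcup_(w in [set w | A (ext w)]) cylinder (ext w) n.
  apply/seteqP; split=> rho /=.
    move=> Arho; exists [ffun i : 'I_n.+1 => rho i] => /=.
      by apply: hA Arho => i ilen; rewrite /ext ffunE inordK.
    by move=> i ilen; rewrite /ext ffunE inordK.
  by move=> [w /= Aw hw]; apply: hA Aw => i ilen; rewrite hw.
apply: fin_bigcup_measurable; first exact: finite_finset.
by move=> w _; apply: sub_sigma_algebra; exists (ext w), n.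
Qed.

Lemma measurable_reward (j : 'I_d) :
  measurable_fun [set: run M] (reward j : run M -> R).
Proof.
move=> _ B _; rewrite setTI.
pose H n := [set rho : run M | [/\ (rho n).1 \in T,
  forall i, (i < n)%N -> (rho i).1 \notin T & B (ratr (r (rho n).1 j))]].
pose N n := [set rho : run M | (rho n).1 \notin T /\ B 0].
have -> : reward j @^-1` B = (\bigcup_n H n) `|` (\bigcap_n N n).
  apply/seteqP; split=> rho /=.
    rewrite /reward; case: pselect => [hit|nhit] hB.
      left; move: hB; case: ex_minnP => m hm minm hB.
      exists m => //; split=> // i im; apply/negP => /minm.
      by rewrite leqNgt im.
    by right=> n _; split=> //; apply/negP => hn; apply: nhit; exists n.
  rewrite /reward; case: pselect => [hit|nhit].
    case=> [[n _ [hn minn hB]]|]; last first.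
      by case: hit => n hn /(_ n I)[]; rewrite hn.
    case: ex_minnP => m hm minm.
    suff -> : m = n by [].
    apply/eqP; rewrite eqn_leq minm //= leqNgt; apply/negP => /minn.
    by rewrite hm.
  case=> [[n _ [hn _ _]]|]; first by case: nhit; exists n.
  by move=> /(_ 0%N I)[].
apply: measurableU.
  apply: bigcup_measurable => n _; apply: (@measurable_prefix n).
  move=> rho rho' e [h1 h2 h3]; split; rewrite -?e //.
  by move=> i lin; rewrite -e ?h2 // ltnW.
apply: bigcap_measurable => // n _; apply: (@measurable_prefix n).
by move=> rho rho' e [h1 h2]; split; rewrite -?e.
Qed.

HB.instance Definition _ (j : 'I_d) :=
  isMeasurableFun.Build _ _ (run M) R (reward j) (@measurable_reward j).

End WeightedReachability.

Section RiskMeasures.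
Context (dT : measure_display) (Omega : measurableType dT) (R : realType).
Context (P : probability Omega R).

(** For [0 < p < 1] the set is nonempty and bounded above, so the real
    supremum is the intended one. *)
Definition VaR (Y : {RV P >-> R}) (p : R) : R :=
  sup [set x : R | (cdf Y x <= p%:E)%E].

Definition CVaR (Y : {RV P >-> R}) (p : R) : \bar R :=
  let v := VaR Y p in
  ((p^-1)%:E *
   (\int[distribution P Y]_(x in `]-oo, v[) x%:E
    + (p%:E - P [set w | (Y w < v)%R]) * v%:E))%E.

End RiskMeasures.

(** [None] stands for the trivially satisfied bound. *)
Record query (R : realType) (d : nat) := Query {
  q_exp : 'I_d -> option rat;
  q_cvar : 'I_d -> option rat;
  q_var : 'I_d -> option rat;
  q_p : 'I_d -> R;
  q_q : 'I_d -> R;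
  q_p01 : forall j, 0 < q_p j < 1;
  q_q01 : forall j, 0 < q_q j < 1
}.

Definition meets (R : realType) (b : option rat) (x : \bar R) : Prop :=
  if b is Some c then ((ratr c)%:E <= x)%E else True.

Section Satisfaction.
Context (R : realType) (M : mdp R) (T : {set state M}) (d : nat).
Context (r : state M -> 'I_d -> rat) (Q : query R d).

Definition satisfies (Mem : countType) (sigma : strategy M Mem) : Prop :=
  exists2 P : probability (run M) R, induced_measure sigma P &
    forall j : 'I_d,
      let X : {RV P >-> R} := reward T r j in
      [/\ meets (q_exp Q j) ('E_P[X])%E,
          meets (q_cvar Q j) (CVaR X (q_p Q j)) &
          meets (q_var Q j) (VaR X (q_q Q j))%:E].

End Satisfaction.

(** Memory of size [k]; both the next move and the memory update may
    randomize. *)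
Definition memory_sufficient (k : nat) (R : realType) (M : mdp R)
    (T : {set state M}) (d : nat) (r : state M -> 'I_d -> rat) : Prop :=
  forall Q : query R d,
    (exists (Mem : countType) (sigma : strategy M Mem), satisfies T r Q sigma) ->
    exists sigma : strategy M 'I_k, satisfies T r Q sigma.

(* Main.v *)
(** All the risk measures of a query depend only on the probabilities [y t] that [t] is the
    first target visited, so it suffices to realise the vector [y] of the given strategy
    [sigma] (or, for nonnegative rewards, a larger vector, since then increasing [y] increases
    the mean of every nondecreasing function of the rewards, and CVaR at level [p] is
    [1/p] times the maximum over [u] of [p u - E (u - X)^+]).

    Let [alpha_k s] be the probability under [sigma] of being in [s] at time [k] without having
    visited [T] before, and [U] the set of states where [alpha_k] does not tend to 0: from
    each of them some action surely remains in [U]. The expected numbers of uses of the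
    actions up to time [n] satisfy flow equations with right-hand side tending to [y] outside
    [U]. These numbers may diverge, but a finitely generated cone is closed, so there is a
    finite flow [x], leaking [z s] at the states [s] of [U], with the target masses [y].
    The two-memory strategy follows [x] and, with the conditional probability given by [z],
    switches for ever to a strategy that remains in [U]. Without the switch the probability of
    each target can only increase, and memory is no longer needed.

    The run measure of a finite-memory strategy is the image of Lebesgue measure on [[0, 1[]
    by iterated inverse cumulative distribution functions. *)
Require Import Defs.
From HB Require Import structures.
From mathcomp Require Import all_boot all_order all_algebra.
From mathcomp Require Import all_classical all_reals all_analysis.
From mathcomp Require Import ring lra.

Set Implicit Arguments.
Unset Strict Implicit.
Unset Printing Implicit Defensive.

Import Order.TTheory GRing.Theory Num.Theory.
Import numFieldNormedType.Exports.

Local Open Scope classical_set_scope.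
Local Open Scope ring_scope.

(** * Finitely generated cones are closed *)

(** A linear relation [u] among the rows of [A] in the support of [x] allows moving [x] along [- u]
    until a coordinate vanishes, without changing [x *m A]. Induction on the size of the support
    ends when those rows are independent. *)
Lemma caratheodory (F : realFieldType) (m n : nat) (A : 'M[F]_(m, n)) (x : 'rV[F]_m) :
  (forall i, 0 <= x 0 i) ->
  exists y : 'rV[F]_m, [/\ forall i, 0 <= y 0 i, y *m A = x *m A &
    forall u : 'rV[F]_m, (forall i, y 0 i = 0 -> u 0 i = 0) -> u *m A = 0 -> u = 0].
Proof.
have [k] := ubnP #|[set i | x 0 i != 0]%SET|.
elim: k x => // k IH x; rewrite ltnS => cardx x0.
have [indep|] := pselect (forall u : 'rV[F]_m,
    (forall i, x 0 i = 0 -> u 0 i = 0) -> u *m A = 0 -> u = 0).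
  by exists x.
move=> /existsNP[u0] /not_implyP[su0 /not_implyP[u0A u0n0]].
(* Replacing [u0] by its opposite if necessary gives a relation with a positive coordinate. *)
have [u [su uA [i0 ui0]]] : exists u : 'rV[F]_m,
    [/\ forall i, x 0 i = 0 -> u 0 i = 0, u *m A = 0 & exists i, 0 < u 0 i].
  have [i u0i] : exists i, u0 0 i != 0.
    by apply: contra_notP u0n0 => /forallNP h; apply/rowP => i; rewrite mxE;
      apply/eqP; apply: contraT => /h.
  case: (ltgtP (u0 0 i) 0) u0i => // ui _.
  - exists (- u0); split; last by exists i; rewrite mxE oppr_gt0.
    + by move=> j /su0; rewrite mxE => ->; rewrite oppr0.
    + by rewrite mulNmx u0A oppr0.
  - by exists u0; split=> //; exists i.
(* The smallest ratio [x / u] is the longest move that keeps every coordinate nonnegative, and it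
   kills coordinate [j]. *)
case: (@Order.TotalTheory.arg_minP _ F _ i0 (fun i => 0 < u 0 i)
  (fun i => x 0 i / u 0 i) ui0) => j uj minj.
pose t := x 0 j / u 0 j.
have t0 : 0 <= t by rewrite divr_ge0 // ltW.
pose y := x - t *: u.
have yE i : y 0 i = x 0 i - t * u 0 i by rewrite !mxE.
have y0 i : 0 <= y 0 i.
  rewrite yE subr_ge0; have [ui|ui] := ltP 0 (u 0 i).
    by rewrite -ler_pdivlMr //; exact: minj.
  by apply: le_trans (x0 i); rewrite mulr_ge0_le0.
have [|z [z0 zA zi]] := IH y _ y0.
  apply: leq_trans cardx; apply: proper_card; apply/properP; split.
    apply/fintype.subsetP => i; rewrite !inE; apply: contra => /eqP xi.
    by rewrite yE xi su // mulr0 subr0.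
  exists j; rewrite !inE.
    by apply: contraTneq uj => /su ->; rewrite ltxx.
  by rewrite negbK yE /t divfK ?subrr // gt_eqF.
by exists z; split=> //; rewrite zA mulmxBl -scalemxAl uA scaler0 subr0.
Qed.

Lemma cvg_sumr (R : realType) (I : Type) (r : seq I) (P : pred I)
    (f : I -> nat -> R) (l : I -> R) :
  (forall i, P i -> f i k @[k --> \oo] --> l i) ->
  \sum_(i <- r | P i) f i k @[k --> \oo] --> \sum_(i <- r | P i) l i.
Proof. by move=> fl; apply: cvg_big => //; exact: add_continuous. Qed.

Lemma cvg_mulmx (R : realType) (m n : nat) (C : 'M[R]_(m, n))
    (b_ : nat -> 'rV[R]_m) (b : 'rV[R]_m) :
  (forall j, b_ k 0 j @[k --> \oo] --> b 0 j) ->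
  forall i, (b_ k *m C) 0 i @[k --> \oo] --> (b *m C) 0 i.
Proof.
move=> bcvg i; rewrite mxE.
under eq_cvg do rewrite mxE.
by apply: cvg_sumr => j _; apply: cvgM; [exact: bcvg|exact: cvg_cst].
Qed.

(* By Caratheodory, each [b_ k] has a representation with linearly independent support;
   one support [I] occurs infinitely often, and on [I] the representation is the image of
   [b_ k] under a left inverse [L], so it passes to the limit. *)
Lemma cone_closed (R : realType) (m n : nat) (A : 'M[R]_(m, n))
    (b_ : nat -> 'rV[R]_n) (b : 'rV[R]_n) :
  (forall k, exists2 x : 'rV[R]_m, forall i, 0 <= x 0 i & x *m A = b_ k) ->
  (forall j, b_ k 0 j @[k --> \oo] --> b 0 j) ->
  exists2 x : 'rV[R]_m, forall i, 0 <= x 0 i & x *m A = b.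
Proof.
move=> bcone bcvg.
have /choice[y yP] k : exists y : 'rV[R]_m, [/\ forall i, 0 <= y 0 i, y *m A = b_ k &
    forall u : 'rV[R]_m, (forall i, y 0 i = 0 -> u 0 i = 0) -> u *m A = 0 -> u = 0].
  by have [x x0 <-] := bcone k; exact: caratheodory.
pose supp k := [set i | y k 0 i != 0]%SET.
(* Pigeonhole: if each set [I] occurred only before a bound [N I], the support at index [\max_I N I]
   would be none of them. *)
have [I Iinf] : exists I, forall N, exists2 k, (N <= k)%N & supp k = I.
  apply: contrapT => /forallNP noI.
  have /choice[N NP] I : exists N, forall k, (N <= k)%N -> supp k <> I.
    have /existsNP[N hN] := noI I; exists N => k Nk e.
    by apply: hN; exists k.
  by apply: (NP (supp (\max_I N I)%N) (\max_I N I)%N) => //; exact: leq_bigmax.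
pose f := @enum_val _ (mem I).
(* Multiplication by [E] extends a row indexed by [I] by zeros, and [B] consists of the rows of [A]
   in [I]. *)
pose E : 'M[R]_(#|I|, m) := rowsub f 1%:M.
pose B := E *m A; pose L := pinvmx B.
have EE (z : 'rV[R]_#|I|) i (iI : i \in I) : (z *m E) 0 i = z 0 (enum_rank_in iI i).
  rewrite mxE (bigD1 (enum_rank_in iI i)) //= !mxE /f enum_rankK_in // eqxx mulr1.
  rewrite big1 ?addr0 // => j ji; rewrite !mxE.
  case: eqP => [e|]; last by rewrite mulr0.
  by case/eqP: ji; apply: enum_val_inj; rewrite enum_rankK_in.
have EE0 (z : 'rV[R]_#|I|) i : i \notin I -> (z *m E) 0 i = 0.
  move=> iI; rewrite mxE big1 // => j _; rewrite !mxE.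
  by case: eqP => [e|]; rewrite ?mulr0 //; move: iI; rewrite -e enum_valP.
have Bfree : row_free B.
  have [k _ kI] := Iinf 0%N; have [_ _ yi] := yP k.
  apply: inj_row_free => v; rewrite mulmxA => /yi vE0.
  have {}vE0 : v *m E = 0.
    apply: vE0 => i yi0; apply: EE0; by rewrite -kI inE yi0 eqxx.
  apply/rowP => j; rewrite mxE.
  have := congr1 (fun M : 'rV[R]_m => M 0 (f j)) vE0.
  by rewrite (EE _ _ (enum_valP j)) enum_valK_in mxE.
have rep k : supp k = I -> (b_ k *m L) *m E = y k.
  move=> kI; have [_ yA _] := yP k.
  pose z : 'rV[R]_#|I| := \row_j y k 0 (f j).
  have zE : z *m E = y k.
    apply/rowP => i; have [iI|iI] := boolP (i \in I).
      by rewrite (EE _ _ iI) mxE /f enum_rankK_in.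
    rewrite EE0 //; apply/esym/eqP; apply: contraNT iI => yi.
    by rewrite -kI inE.
  by rewrite -yA -zE -(mulmxA z E A) -/B -(mulmxA z) mulmxVp ?mulmx1.
(* Only the indices [k] with support [I] are controlled. A violation at the limit would persist for
   all large [k], hence for one of those. *)
exists ((b *m L) *m E).
  move=> i; rewrite -mulmxA leNgt; apply/negP => neg.
  have := @cvg_mulmx _ _ _ (L *m E) _ _ bcvg i.
  move=> /cvgr_lt /(_ _ neg)[N _ Nneg].
  have [k Nk kI] := Iinf N.
  have := Nneg k Nk; rewrite /= mulmxA rep // ltNge.
  by have [-> _ _] := yP k.
apply/rowP => i; rewrite -(mulmxA _ E A) -(mulmxA b L); apply/eqP; apply: contraT => ne.
have cv : ((b_ k *m (L *m (E *m A))) 0 i - b_ k 0 i) @[k --> \oo] -->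
    (b *m (L *m (E *m A))) 0 i - b 0 i.
  by apply: cvgB => //; exact: cvg_mulmx.
rewrite -subr_eq0 in ne.
have /cvgr_neq0 /(_ ne)[N _ Nne] := cv.
have [k Nk kI] := Iinf N.
have := Nne k Nk; rewrite /= (mulmxA (b_ k)) (mulmxA _ E) rep //.
by have [_ -> _] := yP k; rewrite subrr eqxx.
Qed.

Lemma sum_enum_val (R : nmodType) (G : finType) (F : G -> R) :
  \sum_(i < #|G|) F (enum_val i) = \sum_g F g.
Proof. by rewrite [RHS](reindex _ (onW_bij _ (enum_val_bij G))). Qed.

Lemma finite_cone_closed (R : realType) (G S : finType) (A : G -> S -> R)
    (b_ : nat -> S -> R) (b : S -> R) :
  (forall k, exists2 x : G -> R, forall g, 0 <= x g &
     forall s, \sum_g x g * A g s = b_ k s) ->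
  (forall s, b_ k s @[k --> \oo] --> b s) ->
  exists2 x : G -> R, forall g, 0 <= x g & forall s, \sum_g x g * A g s = b s.
Proof.
move=> bcone bcvg.
pose MA : 'M[R]_(#|G|, #|S|) := \matrix_(i, j) A (enum_val i) (enum_val j).
have [|j|x x0 xA] := @cone_closed _ _ _ MA (fun k => \row_j b_ k (enum_val j))
    (\row_j b (enum_val j)).
- move=> k; have [x x0 xA] := bcone k.
  exists (\row_i x (enum_val i)); first by move=> i; rewrite mxE.
  apply/rowP => j; rewrite !mxE -xA -[RHS]sum_enum_val.
  by apply: eq_bigr => i _; rewrite !mxE.
- by rewrite mxE; under eq_cvg do rewrite mxE; exact: bcvg.
exists (fun g => x 0 (enum_rank g)) => // s.
have := congr1 (fun M : 'rV[R]_#|S| => M 0 (enum_rank s)) xA.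
rewrite !mxE enum_rankK => <-; rewrite -[LHS]sum_enum_val.
by apply: eq_bigr => i _; rewrite mxE enum_valK enum_rankK.
Qed.

(** * Events determined by a prefix of a process *)

(** Serves to extend a prefix by one step: only the values up to time [n.+1] matter. *)
Definition redirect (E : Type) (rho : nat -> E) (n : nat) (e : E) : nat -> E :=
  fun i => if (i <= n)%N then rho i else e.

Section Processes.
Context (R : realType) (dT : measure_display) (Omega : measurableType dT).
Context (P : probability Omega R) (E : finType) (Z : nat -> Omega -> E).
Hypothesis mZ : forall n e, measurable (Z n @^-1` [set e]).

Definition pr (A : set Omega) : R := fine (P A).

Lemma prE (A : set Omega) : measurable A -> P A = (pr A)%:E.
Proof. by move=> mA; rewrite /pr fineK // fin_num_measure. Qed.

Lemma pr_ge0 (A : set Omega) : 0 <= pr A.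
Proof. exact: fine_ge0. Qed.

Lemma pr_partition (F : finType) (f : Omega -> F) (A : set Omega) :
  (forall x, measurable (f @^-1` [set x])) -> measurable A ->
  pr A = \sum_x pr (A `&` f @^-1` [set x]).
Proof.
move=> mf mA; apply: EFin_inj; rewrite -prE // -sumEFin.
have AE : A = \bigcup_(x in [set` index_enum F]) (A `&` f @^-1` [set x]).
  apply/seteqP; split=> [w Aw|w [x _ []//]].
  by exists (f w) => //=; rewrite mem_index_enum.
rewrite [in LHS]AE measure_fin_bigcup //=.
- rewrite -fsbig_seq ?index_enum_uniq //; apply: eq_bigr => x _.
  by rewrite prE //; exact: measurableI.
- by move=> x y _ _ [w [[_ <-] [_ <-]]].
- by move=> x _; exact: measurableI.
Qed.

Definition prefix_event (rho : nat -> E) (n : nat) : set Omega :=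
  [set w | forall i, (i <= n)%N -> Z i w = rho i].

Definition prefix_dep (n : nat) (Q : (nat -> E) -> Prop) : Prop :=
  forall rho rho', (forall i, (i <= n)%N -> rho i = rho' i) -> Q rho -> Q rho'.

Definition path_event (Q : (nat -> E) -> Prop) : set Omega :=
  [set w | Q (Z ^~ w)].

Lemma measurable_prefix_event rho n : measurable (prefix_event rho n).
Proof.
have -> : prefix_event rho n =
    \bigcap_(i in [set i | (i <= n)%N]) (Z i @^-1` [set rho i]).
  by apply/seteqP; split=> w h i /=; exact: h.
by apply: bigcap_measurable => [|i _]; [exists 0%N|exact: mZ].
Qed.

Definition path_prefix (n : nat) (w : Omega) : {ffun 'I_n.+1 -> E} :=
  [ffun i => Z (val i) w].

Definition path_ext (n : nat) (h : {ffun 'I_n.+1 -> E}) (i : nat) : E := h (inord i).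

Lemma path_prefixE n h :
  path_prefix n @^-1` [set h] = prefix_event (path_ext h) n.
Proof.
apply/seteqP; split=> w /=.
  by move=> <- i le_in; rewrite /path_ext ffunE /= inordK.
move=> hw; apply/ffunP => i; rewrite ffunE hw ?leq_ord //.
by rewrite /path_ext inord_val.
Qed.

Lemma measurable_path_prefix n h : measurable (path_prefix n @^-1` [set h]).
Proof. by rewrite path_prefixE; exact: measurable_prefix_event. Qed.

Lemma path_eventI n Q h : prefix_dep n Q ->
  path_event Q `&` path_prefix n @^-1` [set h] =
  if `[< Q (path_ext h) >] then prefix_event (path_ext h) n else set0.
Proof.
move=> dQ; rewrite path_prefixE; case: asboolP => Qh.
  apply/seteqP; split=> w /=; first by case.
  by move=> hw; split=> //; apply: dQ Qh => i le_in; rewrite hw.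
apply/seteqP; split=> // w [/= Qw hw]; apply: Qh.
by apply: dQ Qw => i le_in; rewrite hw.
Qed.

Lemma measurable_path_event n Q : prefix_dep n Q -> measurable (path_event Q).
Proof.
move=> dQ.
have -> : path_event Q =
    \bigcup_(h in [set: {ffun 'I_n.+1 -> E}]) (path_event Q `&` path_prefix n @^-1` [set h]).
  by apply/seteqP; split=> [w Qw|w [h _ []//]]; exists (path_prefix n w).
apply: fin_bigcup_measurable => [|h _]; first exact: finite_finset.
rewrite path_eventI //; case: ifP => _ //; exact: measurable_prefix_event.
Qed.

(** Elementary form of conditioning on the past: [Q] is a finite disjoint union of prefix events,
    and the identity is summed over them. *)
Lemma pr_path_event_condition n Q (B : set Omega) (c : R) :
  prefix_dep n Q -> measurable B ->
  (forall rho, Q rho -> pr (prefix_event rho n `&` B) = c * pr (prefix_event rho n)) ->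
  pr (path_event Q `&` B) = c * pr (path_event Q).
Proof.
move=> dQ mB QB; have mQ := measurable_path_event dQ.
rewrite (pr_partition (@measurable_path_prefix n)); last exact: measurableI.
rewrite (pr_partition (@measurable_path_prefix n) mQ) mulr_sumr.
apply: eq_bigr => h _; rewrite setIAC path_eventI //.
case: asboolP => [/QB //|_]; by rewrite set0I /pr measure0 mulr0.
Qed.

End Processes.

(** * Existence of finite Markov chains *)

Section InverseCdf.
Context (R : realType) (E : finType) (mu : E -> R).
Hypotheses (mu_ge0 : forall e, 0 <= mu e) (mu_sum1 : \sum_e mu e = 1).

Definition cumul_below (k : nat) : R := \sum_(e | (enum_rank e < k)%N) mu e.

Definition cumul (e : E) : R := cumul_below (enum_rank e).

Lemma cumul_belowS (e : E) : cumul_below (enum_rank e).+1 = cumul e + mu e.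
Proof.
rewrite /cumul /cumul_below (bigD1 e) //= addrC; congr (_ + _).
apply: eq_bigl => e'; rewrite ltnS andbC ltn_neqAle; congr (_ && _).
by rewrite (inj_eq val_inj) (inj_eq enum_rank_inj).
Qed.

Lemma cumul_below_le (k l : nat) : (k <= l)%N -> cumul_below k <= cumul_below l.
Proof.
move=> kl; rewrite /cumul_below [leRHS](bigID (fun e => (enum_rank e < k)%N)) /=.
rewrite [X in X + _](eq_bigl (fun e => (enum_rank e < k)%N)) ?lerDl ?sumr_ge0 //.
by move=> e; apply: andb_idl => /leq_trans; apply.
Qed.

Lemma cumul_ge0 e : 0 <= cumul e.
Proof. exact: sumr_ge0. Qed.

Lemma cumulD_le1 e : cumul e + mu e <= 1.
Proof.
rewrite -cumul_belowS -mu_sum1 [leRHS](bigID (fun e' => (enum_rank e' < (enum_rank e).+1)%N)).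
by rewrite /= lerDl sumr_ge0.
Qed.

(** The slots tile the interval from 0 to 1 in the order of the enumeration; a value of probability
    0 gets an empty slot. *)
Definition in_slot (v : R) (e : E) : bool := cumul e <= v < cumul e + mu e.

Lemma in_slot_inj v e e' : in_slot v e -> in_slot v e' -> e = e'.
Proof.
wlog : e e' / (enum_rank e <= enum_rank e')%N.
  move=> W h h'; case: (leqP (enum_rank e) (enum_rank e')) => [le|/ltnW le].
    exact: W.
  by apply/esym; exact: W.
rewrite leq_eqVlt => /orP[/eqP /val_inj /enum_rank_inj //|lt].
move=> /andP[_ h1] /andP[h2 _]; move: h1.
rewrite -cumul_belowS => /lt_le_trans /(_ (cumul_below_le lt)).
by rewrite ltNge h2.
Qed.

Lemma in_slot_ex v : 0 <= v < 1 -> exists e, in_slot v e.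
Proof.
move=> /andP[v0 v1].
have ex : exists k, v < cumul_below k.
  exists #|E|; rewrite /cumul_below (eq_bigl xpredT) ?mu_sum1 // => e.
  exact: ltn_ord.
case: (ex_minnP ex) => -[|k] vk mink.
  by move: vk; rewrite /cumul_below big_pred0 // ltNge v0.
have kE : (k < #|E|)%N.
  rewrite ltnNge; apply/negP => Ek.
  suff /mink : v < cumul_below k by rewrite ltnn.
  congr (_ < _): vk; apply: eq_bigl => e.
  have eE : (enum_rank e < k)%N by apply: leq_trans Ek; exact: ltn_ord.
  by rewrite eE ltnS ltnW.
exists (enum_val (Ordinal kE)); rewrite /in_slot -cumul_belowS /cumul enum_valK /= vk andbT.
by rewrite leNgt; apply/negP => /mink; rewrite ltnn.
Qed.

(* The rescaled position of [v] in its slot is again uniform on [[0, 1[], hence drives the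
   next transition. *)
Definition select (e0 : E) (v : R) : E * R :=
  let e := odflt e0 [pick e | in_slot v e] in (e, (v - cumul e) / mu e).

Lemma select_in e0 v : 0 <= v < 1 -> in_slot v (select e0 v).1.
Proof.
move=> /in_slot_ex[e ve]; rewrite /select; case: pickP => //= /(_ e).
by rewrite ve.
Qed.

Lemma select_eq e0 v e : 0 <= v < 1 -> ((select e0 v).1 = e <-> in_slot v e).
Proof.
move=> v01; split=> [<-|h]; first exact: select_in.
by apply: in_slot_inj h; exact: select_in.
Qed.

Lemma select_pos e0 v : 0 <= v < 1 -> 0 <= (select e0 v).2 < 1.
Proof.
move=> /(select_in e0); rewrite /in_slot /=; set e := odflt _ _ => /andP[h1 h2].
have mu_gt0 : 0 < mu e by rewrite -(ltrD2l (cumul e)) addr0; exact: le_lt_trans h2.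
by rewrite divr_ge0 ?subr_ge0 //= ltr_pdivrMr // mul1r ltrBlDl.
Qed.

End InverseCdf.

Section UniformMeasure.
Context (R : realType).

Lemma measurable_unit_itv : measurable (`[0, 1[ : set (measurableTypeR R)).
Proof. exact: measurable_itv. Qed.

Definition unit_measure : set (measurableTypeR R) -> \bar R :=
  mrestr lebesgue_measure measurable_unit_itv.

HB.instance Definition _ := Measure.on unit_measure.

Lemma unit_measure_setT : unit_measure setT = 1%E.
Proof.
by rewrite /unit_measure /mrestr setTI lebesgue_measure_itv /= lte01 oppr0 adde0.
Qed.

HB.instance Definition _ :=
  Measure_isProbability.Build _ _ R unit_measure unit_measure_setT.

End UniformMeasure.

Section MarkovChain.
Context (R : realType) (E : finType) (e0 : E) (nu : E -> R) (K : E -> E -> R).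
Hypotheses (nu_ge0 : forall e, 0 <= nu e) (nu_sum1 : \sum_e nu e = 1).
Hypotheses (K_ge0 : forall e e', 0 <= K e e') (K_sum1 : forall e, \sum_e' K e e' = 1).

(** The chain is defined on all reals although only the unit interval has mass; clipping lets the
    facts on positions hold for every [u]. *)
Definition unit_clip (u : R) : R := if 0 <= u < 1 then u else 0.

Fixpoint chain_pos (n : nat) (u : R) : E * R :=
  if n is n'.+1 then let: (e, v) := chain_pos n' u in select (K e) e0 v
  else select nu e0 (unit_clip u).

Definition chain_path (n : nat) (u : measurableTypeR R) : E := (chain_pos n u).1.

Fixpoint path_mass (rho : nat -> E) (n : nat) : R :=
  if n is n'.+1 then path_mass rho n' * K (rho n') (rho n) else nu (rho 0%N).

(** The points that drive the chain along [rho] up to time [n] form an interval with this left end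
    and length [path_mass rho n]. *)
Fixpoint path_low (rho : nat -> E) (n : nat) : R :=
  if n is n'.+1 then path_low rho n' + path_mass rho n' * cumul (K (rho n')) (rho n)
  else cumul nu (rho 0%N).

Lemma unit_clip01 u : 0 <= unit_clip u < 1.
Proof. by rewrite /unit_clip; case: ifP => // _; rewrite lexx ltr01. Qed.

Lemma chain_pos01 n u : 0 <= (chain_pos n u).2 < 1.
Proof.
elim: n => [|n IH] /=; first by apply: select_pos => //; exact: unit_clip01.
by case: (chain_pos n u) IH => e v /= v01; exact: select_pos.
Qed.

Lemma path_mass_ge0 rho n : 0 <= path_mass rho n.
Proof. by elim: n => //= n IH; rewrite mulr_ge0. Qed.

Lemma eq_path_mass (rho rho' : nat -> E) n : (forall i, (i <= n)%N -> rho i = rho' i) ->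
  path_mass rho n = path_mass rho' n.
Proof.
elim: n => [|n IH] e /=; first by rewrite e.
by rewrite IH ?e // => i le_in; exact: e (leqW le_in).
Qed.

(** The two claims are proved together: the next state is selected by the residual position, which
    is the affine rescaling of the current interval. The next interval is thus a slot of the current
    one. *)
Lemma chain_path_slot rho n u :
  ((forall i, (i <= n)%N -> chain_path i u = rho i) <->
   path_low rho n <= unit_clip u < path_low rho n + path_mass rho n) /\
  ((forall i, (i <= n)%N -> chain_path i u = rho i) ->
   (chain_pos n u).2 = (unit_clip u - path_low rho n) / path_mass rho n).
Proof.
elim: n => [|n [IH1 IH2]] /=.
  have sel := select_eq nu_ge0 nu_sum1 e0 (rho 0%N) (unit_clip01 u).
  split; last by move=> /(_ 0%N isT); rewrite /chain_path /= /select /= => ->.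
  rewrite -[X in _ <-> is_true X]/(in_slot nu (unit_clip u) (rho 0%N)) -sel.
  by split=> [/(_ 0%N isT)//|h i]; rewrite leqn0 => /eqP ->.
have pre : (forall i, (i <= n.+1)%N -> chain_path i u = rho i) <->
    (forall i, (i <= n)%N -> chain_path i u = rho i) /\ chain_path n.+1 u = rho n.+1.
  split=> [h|[h h'] i]; first by split=> [i le_in|]; apply: h => //; exact: leqW.
  by rewrite leq_eqVlt => /orP[/eqP ->//|]; rewrite ltnS; exact: h.
set m := path_mass rho n in IH1 IH2 *; set l := path_low rho n in IH1 IH2 *.
have m0 : 0 <= m by exact: path_mass_ge0.
have step : (forall i, (i <= n)%N -> chain_path i u = rho i) ->
    chain_pos n.+1 u = select (K (rho n)) e0 ((unit_clip u - l) / m).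
  by move=> h; have := IH2 h; have := h n (leqnn n);
    rewrite /chain_path /=; case: (chain_pos n u) => e v /= -> ->.
have slot v e : 0 < m -> l + m * cumul (K (rho n)) e <= v <
      l + m * cumul (K (rho n)) e + m * K (rho n) e <->
    in_slot (K (rho n)) ((v - l) / m) e.
  move=> m_gt0; rewrite /in_slot ler_pdivlMr // ltr_pdivrMr //.
  by rewrite lerBrDl ltrBlDl mulrDl addrA ![_ * m]mulrC.
split.
  rewrite pre; split=> [[h h']|h].
    have [lu um] := andP (proj1 IH1 h).
    have m_gt0 : 0 < m by rewrite -(ltrD2l l) addr0; exact: le_lt_trans um.
    apply/slot => //; rewrite -select_eq //; last first.
      by have := chain_pos01 n u; rewrite IH2.
    by rewrite -h' /chain_path step.
  have m_gt0 : 0 < m.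
    rewrite lt_neqAle m0 andbT; apply: contraTneq h => <-.
    by rewrite !mul0r !addr0; apply/negP => /andP[/le_lt_trans lt /lt]; rewrite ltxx.
  have := h => /(slot _ _ m_gt0) sl.
  have hn : forall i, (i <= n)%N -> chain_path i u = rho i.
    apply/IH1; case/andP: sl => sl1 sl2.
    have : 0 <= (unit_clip u - l) / m < 1.
      by rewrite (le_trans _ sl1) ?cumul_ge0 //= (lt_le_trans sl2) // cumulD_le1.
    by rewrite ler_pdivlMr // ltr_pdivrMr // mul0r mul1r subr_ge0 ltrBlDl.
  split=> //; rewrite /chain_path step //.
  by apply/select_eq => //; have := chain_pos01 n u; rewrite IH2.
move=> /pre[h h']; have := step h; rewrite /= => ->; rewrite /select /=.
have -> : odflt e0 [pick e | in_slot (K (rho n)) ((unit_clip u - l) / m) e] = rho n.+1.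
  by rewrite -h' /chain_path step.
have m_n0 : m != 0.
  apply: contraTneq (proj1 IH1 h) => ->.
  by rewrite addr0; apply/negP => /andP[/le_lt_trans lt /lt]; rewrite ltxx.
rewrite opprD addrA invfM mulrA; congr (_ * _).
by rewrite [RHS]mulrBl mulrAC divff // mul1r.
Qed.

Lemma path_mass_prefix_bound rho n :
  0 <= path_low rho n /\ path_low rho n + path_mass rho n <= 1.
Proof.
elim: n => [|n [IH1 IH2]] /=; first by rewrite cumul_ge0 // cumulD_le1.
have m0 := path_mass_ge0 rho n.
rewrite addr_ge0 ?mulr_ge0 ?cumul_ge0 //; split=> //; apply: le_trans IH2.
by rewrite -addrA lerD2l -mulrDr ler_piMr // cumulD_le1.
Qed.

Lemma chain_path_prefix_itv rho n :
  prefix_event chain_path rho n `&` `[0, 1[ =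
  [set` `[path_low rho n, path_low rho n + path_mass rho n[ ].
Proof.
have [l0 lm1] := path_mass_prefix_bound rho n.
apply/seteqP; split=> u /=; rewrite !in_itv /=.
  move=> [/(proj1 (proj1 (chain_path_slot rho n u)))].
  by rewrite /unit_clip => + u01; rewrite u01.
move=> /andP[lu ul].
have u01 : 0 <= u < 1 by rewrite (le_trans l0 lu) (lt_le_trans ul lm1).
split=> //; apply/(proj1 (chain_path_slot rho n u)).
by rewrite /unit_clip u01 lu ul.
Qed.

Lemma chain_path_clip n u : chain_path n (unit_clip u) = chain_path n u.
Proof.
suff e : chain_pos n (unit_clip u) = chain_pos n u by rewrite /chain_path e.
elim: n => [|n IH] /=; last by rewrite IH.
by rewrite {1}/unit_clip unit_clip01.
Qed.

(** Outside the unit interval every point follows the path of 0, so that part of the event is empty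
    or the whole complement. *)
Lemma measurable_chain_prefix rho n : measurable (prefix_event chain_path rho n).
Proof.
rewrite -(setIT (prefix_event _ _ _)) -(setUv (`[0, 1[ : set (measurableTypeR R))) setIUr.
apply: measurableU; first by rewrite chain_path_prefix_itv; exact: measurable_itv.
have [h0|h0] := pselect (prefix_event chain_path rho n 0).
  rewrite [X in measurable X](_ : _ = ~` `[0, 1[); first exact: measurableC.
  apply/seteqP; split=> [u []//|u /= u01]; split=> // i le_in.
  by rewrite -(h0 i le_in) -chain_path_clip /unit_clip; move: u01; rewrite in_itv /= => /negP/negbTE ->.
rewrite [X in measurable X](_ : _ = set0) //.
apply/seteqP; split=> // u [hu /= u01]; apply: h0 => i le_in.
rewrite -(hu i le_in) -(chain_path_clip i u) /unit_clip; move: u01.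
by rewrite in_itv /= => /negP/negbTE ->.
Qed.

Lemma measurable_chain_path n e : measurable (chain_path n @^-1` [set e]).
Proof.
pose ext (h : {ffun 'I_n.+1 -> E}) (i : nat) := h (inord i).
have -> : chain_path n @^-1` [set e] =
    \bigcup_(h in [set h : {ffun 'I_n.+1 -> E} | h ord_max = e])
      prefix_event chain_path (ext h) n.
  apply/seteqP; split=> [u /= ue|u [h /= he hu]].
    exists [ffun i : 'I_n.+1 => chain_path i u] => /=; first by rewrite ffunE.
    by move=> i le_in; rewrite /ext ffunE inordK.
  rewrite (hu n (leqnn n)) /ext -he; congr (h _); apply: val_inj.
  by rewrite /= inordK.
apply: fin_bigcup_measurable => [|h _]; first exact: finite_finset.
exact: measurable_chain_prefix.
Qed.

Lemma chain_prefix_prob rho n :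
  unit_measure (prefix_event chain_path rho n) = (path_mass rho n)%:E.
Proof.
rewrite /unit_measure /mrestr chain_path_prefix_itv lebesgue_measure_itv /= lte_fin.
have m0 := path_mass_ge0 rho n; rewrite ltrDl lt_def m0 andbT.
have [->//|_] := eqVneq (path_mass rho n) 0.
by rewrite -EFinB addrAC subrr add0r.
Qed.

End MarkovChain.

(** * Risk measures of finitely valued variables *)

Section FiniteMean.
Context (R : realType) (I : finType) (a y : I -> R).
Hypotheses (y_ge0 : forall i, 0 <= y i) (y_sum : \sum_i y i <= 1).

(* Mean of [f Y] when [Y] takes the value [a i] with probability [y i], and [0] with
   the remaining probability. *)
Definition fmean (f : R -> R) : R := f 0 + \sum_i y i * (f (a i) - f 0).

Lemma fmeanE f : fmean f = (1 - \sum_i y i) * f 0 + \sum_i y i * f (a i).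
Proof.
rewrite /fmean mulrBl mul1r -addrA; congr (_ + _).
rewrite mulr_suml addrC -sumrB; apply: eq_bigr => i _; exact: mulrBr.
Qed.

Lemma fmean_le f g : (forall x, f x <= g x) -> fmean f <= fmean g.
Proof.
move=> fg; rewrite !fmeanE lerD // ?ler_wpM2l ?subr_ge0 //.
by apply: ler_sum => i _; rewrite ler_wpM2l.
Qed.

Lemma fmean_lin c f g : fmean (fun x => c * f x + g x) = c * fmean f + fmean g.
Proof.
rewrite /fmean mulrDr -!addrA; congr (_ + _); rewrite addrCA; congr (_ + _).
rewrite mulr_sumr -big_split /=; apply: eq_bigr => i _; ring.
Qed.

Lemma fmean_cst c : fmean (fun=> c) = c.
Proof. by rewrite /fmean big1 ?addr0 // => i _; rewrite subrr mulr0. Qed.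

Definition fcdf (x : R) : R := fmean (fun z : R => (z <= x)%R%:R).

Definition fvar (p : R) : R := sup [set x | fcdf x <= p].

Definition shortfall (u : R) : R := fmean (fun z => Num.max 0 (u - z)).

Lemma fcdf_le : {homo fcdf : x z / x <= z}.
Proof.
move=> x z xz; apply: fmean_le => t; rewrite ler_nat.
by case: (leP t x) => // tx; rewrite (Order.POrderTheory.le_trans tx xz).
Qed.

Lemma values_bounded : exists B : R, 0 < B /\ forall i, `|a i| < B.
Proof.
exists (1 + \sum_i `|a i|); split; first by rewrite ltr_pwDl // sumr_ge0.
move=> i; rewrite ltr_pwDl // (bigD1 i) //= lerDl sumr_ge0 //.
Qed.

Context (p : R) (p01 : 0 < p < 1).

(** Below all values and 0 the distribution function is 0, above them it is 1, and [p] lies strictly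
    between. *)
Lemma has_sup_fvar : has_sup [set x | fcdf x <= p].
Proof.
have [B [B0 aB]] := values_bounded; have [p0 p1] := andP p01; split.
  exists (- B) => /=; suff -> : fcdf (- B) = 0 by exact: ltW.
  rewrite -[RHS](fmean_cst 0) /fcdf /fmean leNgt oppr_lt0 B0 /=.
  congr (_ + _); apply: eq_bigr => i _.
  by have := aB i; rewrite ltr_norml => /andP[h _]; rewrite leNgt h.
exists B => x /= Fx; rewrite leNgt; apply/negP => /ltW /fcdf_le.
apply/negP; rewrite -ltNge; apply: le_lt_trans Fx _.
suff -> : fcdf B = 1 by [].
rewrite -[RHS](fmean_cst 1) /fcdf /fmean (ltW B0).
congr (_ + _); apply: eq_bigr => i _.
by have := aB i; rewrite ltr_norml => /andP[_ /ltW ->].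
Qed.

Lemma fcdf_lt_fvar w : w < fvar p -> fcdf w <= p.
Proof.
move=> /(sup_gt has_sup_fvar.1)[x /= Fx wx].
by apply: le_trans Fx; apply: fcdf_le; exact: ltW.
Qed.

Lemma fcdf_gt_fvar w : fvar p < w -> p < fcdf w.
Proof.
move=> vw; rewrite ltNge; apply/negP => Fw; move: vw; rewrite ltNge.
by move/negP; apply; apply: (ub_le_sup has_sup_fvar.2).
Qed.

(** The shortfall is convex with slope [fcdf]. Pointwise, the increment of the positive part from
    [u] to [w] is at least [w - u] when [z <= u], at most [w - u], and zero when [w < z]. *)
Lemma shortfall_up u w : u <= w ->
  (w - u) * fcdf u <= shortfall w - shortfall u <= (w - u) * fcdf w.
Proof.
move=> uw; rewrite lerBrDr lerBlDr /fcdf /shortfall -!fmean_lin.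
apply/andP; split; apply: fmean_le => z; rewrite /Num.max.
  by case: (leP z u) => zu; case: (ltP 0 (u - z)) => ?; case: (ltP 0 (w - z)) => ? /=; nra.
by case: (leP z w) => zw; case: (ltP 0 (u - z)) => ?; case: (ltP 0 (w - z)) => ? /=; nra.
Qed.

Lemma fcdf01 w : 0 <= fcdf w <= 1.
Proof.
rewrite -[X in _ <= _ <= X](fmean_cst 1) -[X in X <= _](fmean_cst 0).
by apply/andP; split; apply: fmean_le => z; rewrite ?ler0n ?lern1 ?leq_b1.
Qed.

(** Allows comparing with a point near [fvar p] instead of [fvar p] itself, where the distribution
    function may jump across [p]. *)
Lemma shortfall_gain_lip u w :
  p * u - shortfall u <= p * w - shortfall w + 2 * `|w - u|.
Proof.
have [p0 p1] := andP p01.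
have [uw|/ltW wu] := leP u w.
  have /andP[_ h] := shortfall_up uw; have /andP[_ F1] := fcdf01 w.
  rewrite ger0_norm ?subr_ge0 //; nra.
have /andP[h _] := shortfall_up wu; have /andP[F0 _] := fcdf01 w.
rewrite ler0_norm ?subr_le0 //; nra.
Qed.

(* The maximand is concave in [u], with slope [p - fcdf u]. *)
Lemma fvar_max u : p * u - shortfall u <= p * fvar p - shortfall (fvar p).
Proof.
apply/ler_addgt0Pr => e e0; set v := fvar p.
have [uv|vu|-> ] := ltgtP u v; last by rewrite lerDl ltW.
(* Strictly below [v] the slope is nonnegative, so the maximand does not decrease from [u] to [w];
   the last stretch, of length at most [e / 2], costs at most [e]. *)
- pose w := Num.max u (v - e / 2).
  have wv : w < v by rewrite /w gt_max uv ltrBlDr ltrDl divr_gt0.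
  have uw : u <= w by rewrite /w le_max lexx.
  have we : v - e / 2 <= w by rewrite /w le_max lexx orbT.
  have /andP[_ h] := shortfall_up uw; have Fw := fcdf_lt_fvar wv.
  have := shortfall_gain_lip w v; rewrite gtr0_norm ?subr_gt0 // => lip.
  by nra.
- pose w := Num.min u (v + e / 2).
  have vw : v < w by rewrite /w lt_min vu ltrDl divr_gt0.
  have wu : w <= u by rewrite /w ge_min lexx.
  have we : w <= v + e / 2 by rewrite /w ge_min lexx orbT.
  have /andP[h _] := shortfall_up wu; have Fw := fcdf_gt_fvar vw.
  have := shortfall_gain_lip w v; rewrite ltr0_norm ?subr_lt0 // => lip.
  by nra.
Qed.

End FiniteMean.

(** * Monotonicity of VaR and CVaR under stochastic dominance *)

Section Dominance.
Context (R : realType) (I : finType) (a y y' : I -> R).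
Hypotheses (y_ge0 : forall i, 0 <= y i) (y_sum : \sum_i y i <= 1).
Hypotheses (y'_ge0 : forall i, 0 <= y' i) (y'_sum : \sum_i y' i <= 1).
Hypothesis dom : forall f : R -> R, {homo f : x z / x <= z} ->
  fmean a y f <= fmean a y' f.

Lemma fmeanN (y0 : I -> R) f : fmean a y0 (fun x => - f x) = - fmean a y0 f.
Proof.
have := fmean_lin a y0 (-1) f (fun=> 0); rewrite fmean_cst addr0 mulN1r => <-.
by rewrite /fmean !mulN1r !addr0; congr (_ + _); apply: eq_bigr => i _; rewrite mulN1r addr0.
Qed.

Lemma fmean_antitone f : {homo f : x z /~ x <= z} -> fmean a y' f <= fmean a y f.
Proof.
by move=> f_anti; rewrite -lerN2 -!fmeanN; apply: dom => x z xz; rewrite lerN2 f_anti.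
Qed.

Lemma fvar_dom p : 0 < p < 1 -> fvar a y p <= fvar a y' p.
Proof.
move=> p01; apply: ge_sup.
  by have [] := has_sup_fvar a y_ge0 y_sum p01.
have [_ ub] := has_sup_fvar a y'_ge0 y'_sum p01.
move=> x /= Fx; apply: (ub_le_sup ub) => /=.
apply: le_trans Fx; apply: fmean_antitone => s t st.
by rewrite ler_nat; case: (leP s x) => // sx; rewrite (Order.POrderTheory.le_trans st sx).
Qed.

Lemma shortfall_dom u : shortfall a y' u <= shortfall a y u.
Proof.
apply: fmean_antitone => s t st; rewrite /Num.max.
by case: (ltP 0 (u - s)) => ?; case: (ltP 0 (u - t)) => ?; lra.
Qed.

(** The quantile for [y] is merely one competitor in the maximum that [fvar_max] gives for [y'], and
    the shortfall at that point decreases. *)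
Lemma fcvar_dom p : 0 < p < 1 ->
  p * fvar a y p - shortfall a y (fvar a y p) <=
  p * fvar a y' p - shortfall a y' (fvar a y' p).
Proof.
move=> p01; apply: le_trans (fvar_max a y'_ge0 y'_sum p01 (fvar a y p)).
by rewrite lerD2l lerN2 shortfall_dom.
Qed.

End Dominance.

(** * The law of the reward in terms of the hitting probabilities *)

Section RewardLaw.
Context (R : realType) (M : mdp R) (T : {set state M}) (d : nat).
Context (r : state M -> 'I_d -> rat) (P : probability (run M) R).

(** The condition [t \in T] makes [hit t] empty for other states, so that sums may range over all
    states. *)
Definition hit_at (t : state M) (n : nat) : set (run M) :=
  [set rho | [/\ t \in T, (rho n).1 = t & forall i, (i < n)%N -> (rho i).1 \notin T]].

Definition hit (t : state M) : set (run M) := \bigcup_n hit_at t n.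

Definition hit_prob (t : state M) : R := pr P (hit t).

Lemma measurable_hit_at t n : measurable (hit_at t n).
Proof.
apply: (@measurable_prefix _ _ n) => rho rho' e [tT rt ht]; split=> //.
  by rewrite -e.
by move=> i i_lt_n; rewrite -e ?ht // ltnW.
Qed.

Lemma measurable_hit t : measurable (hit t).
Proof. by apply: bigcup_measurable => n _; exact: measurable_hit_at. Qed.

Lemma trivIset_hit_at t : trivIset setT (hit_at t).
Proof.
move=> m n _ _ [rho [[tT hm mm] [_ hn mn]]].
by case: (ltngtP m n) => // [/mn|/mm]; rewrite ?hm ?hn tT.
Qed.

Lemma hit_inj rho t t' : hit t rho -> hit t' rho -> t = t'.
Proof.
move=> [m _ [tT hm mm]] [n _ [tT' hn mn]].
case: (ltngtP m n) => [/mn|/mm|e]; rewrite ?hm ?hn ?tT ?tT' //.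
by rewrite -hm -hn e.
Qed.

(** At most one of the events [hit t] occurs. Any function of the reward is thus a constant plus a
    finite sum of indicators, which gives its integrability and its mean. *)
Lemma reward_hit (f : R -> R) j rho :
  f (reward T r j rho) =
  f 0 + \sum_t \1_(hit t) rho * (f (ratr (r t j)) - f 0).
Proof.
rewrite /reward; case: pselect => [hitT|nohit]; last first.
  rewrite big1 ?addr0 // => t _; rewrite indicE memNset ?mul0r //.
  by move=> [n _ [tT h _]]; apply: nohit; exists n; rewrite h.
case: ex_minnP => n nT minn; set t := (rho n).1.
have ht : hit t rho.
  exists n => //; split=> // i i_lt_n; apply/negP => /minn.
  by rewrite leqNgt i_lt_n.
rewrite (bigD1 t) //= indicE mem_set // mul1r big1 ?addr0 ?subrKC //.
move=> t' t't; rewrite indicE memNset ?mul0r // => ht'.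
by move: t't; rewrite (hit_inj ht' ht) eqxx.
Qed.

Lemma hit_prob_ge0 t : 0 <= hit_prob t.
Proof. exact: pr_ge0. Qed.

Lemma integral_reward (f : R -> R) j :
  P.-integrable setT (fun rho => (f (reward T r j rho))%:E) /\
  (\int[P]_rho (f (reward T r j rho))%:E =
   (fmean (fun t => ratr (r t j)) hit_prob f)%:E)%E.
Proof.
have mh := measurable_hit.
pose c t := f (ratr (r t j)) - f 0.
have int1 t : P.-integrable setT (fun rho => ((c t)%:E * (\1_(hit t) rho)%:E)%E).
  by apply: integrableZl => //; exact: integrable_indic.
have ints : P.-integrable setT (fun rho => \sum_t ((c t)%:E * (\1_(hit t) rho)%:E)%E)%E.
  exact: integrable_sum.
have int0 : P.-integrable setT (EFin \o cst (f 0)).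
  exact: finite_measure_integrable_cst.
have fE : (fun rho => (f (reward T r j rho))%:E) =
    ((EFin \o cst (f 0%R)) \+ (fun rho => \sum_t ((c t)%:E * (\1_(hit t) rho)%:E)))%E.
  apply/funext => rho; rewrite reward_hit EFinD -sumEFin /=; congr (_ + _)%E.
  by apply: eq_bigr => t _; rewrite -EFinM mulrC.
split; first by rewrite fE; exact: integrableD.
rewrite fE integralD //= integral_cst // [X in (_ * X + _)%E]probability_setT mule1.
rewrite /fmean EFinD -sumEFin integral_sum //; congr (_ + _)%E.
apply: eq_bigr => t _; rewrite integralZl //; last exact: integrable_indic.
by rewrite integral_indic // setIT [X in (_ * X)%E](prE P (mh t)) -EFinM mulrC.
Qed.

Lemma hit_prob_sum : \sum_t hit_prob t <= 1.
Proof.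
have mh := measurable_hit.
rewrite -lee_fin -sumEFin.
rewrite (eq_bigr (fun t => P (hit t))); last by move=> t _; rewrite (prE P (mh t)).
have <- : P (\bigcup_(t in [set` index_enum (state M)]) hit t) = \sum_t P (hit t).
  rewrite measure_fin_bigcup //=; first by rewrite -fsbig_seq // index_enum_uniq.
  by move=> t t' _ _ [rho [h h']]; exact: hit_inj h h'.
apply: probability_le1; apply: fin_bigcup_measurable => [|t _]; last exact: mh.
exact: finite_seq.
Qed.

Let X (j : 'I_d) : {RV P >-> R} := reward T r j.
Let a (j : 'I_d) (t : state M) : R := ratr (r t j).

Lemma expectation_reward j : ('E_P[X j] = (fmean (a j) hit_prob id)%:E)%E.
Proof. by rewrite unlock (integral_reward id j).2. Qed.

Lemma prob_reward (A : set R) j : measurable A ->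
  P (X j @^-1` A) = (fmean (a j) hit_prob \1_A)%:E.
Proof.
move=> mA; rewrite -(integral_reward \1_A j).2.
have := integral_indic P measurableT (measurable_funPTI (X j) mA).
by rewrite setIT => <-.
Qed.

Lemma cdf_reward j x : cdf (X j) x = (fcdf (a j) hit_prob x)%:E.
Proof.
rewrite /cdf /distribution /pushforward prob_reward; last exact: measurable_itv.
rewrite /fcdf; congr (fmean _ _ _)%:E; apply/funext => z.
by rewrite indicE mem_setE in_itv.
Qed.

Lemma VaR_reward j p : VaR (X j) p = fvar (a j) hit_prob p.
Proof.
rewrite /VaR /fvar; congr sup; apply/seteqP.
by split=> x /=; rewrite cdf_reward lee_fin.
Qed.

Lemma CVaR_reward j p :
  CVaR (X j) p = (p^-1 * (p * fvar (a j) hit_prob p -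
    shortfall (a j) hit_prob (fvar (a j) hit_prob p)))%:E.
Proof.
rewrite /CVaR VaR_reward; set v := fvar _ _ _.
have mv : measurable (`]-oo, v[ : set R) by exact: measurable_itv.
pose g z := if z < v then z else 0.
have intg : (\int[distribution P (X j)]_(x in `]-oo, v[) x%:E =
    (fmean (a j) hit_prob g)%:E)%E.
  rewrite /distribution integral_pushforward //; last first.
    apply: (integrableS measurableT) => //.
      by rewrite -[X in measurable X]setTI; exact: measurable_funP.
    exact: (integral_reward id j).1.
  rewrite integral_mkcond -(integral_reward g j).2; apply: eq_integral => rho _.
  rewrite patchE /g; have -> : (rho \in reward T r j @^-1` `]-oo, v[) = (reward T r j rho < v).
    by apply/idP/idP; rewrite inE /= in_itv.
  by case: ifP.
have -> : [set w | (X j w < v)%R] = X j @^-1` `]-oo, v[.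
  by apply/seteqP; split=> w /=; rewrite in_itv.
rewrite intg prob_reward // -EFinB -EFinM; congr (_ * _)%:E.
(* Pointwise, the positive part of [v - z] is [v] times the indicator of [z < v], minus [g z]. *)
have -> : shortfall (a j) hit_prob v =
    - fmean (a j) hit_prob g + v * fmean (a j) hit_prob \1_(`]-oo, v[).
  rewrite addrC -fmeanN -fmean_lin; congr fmean; apply/funext => z.
  rewrite /g indicE mem_setE in_itv /= /Num.max.
  by case: (ltP z v) => ?; case: (ltP 0 (v - z)) => ? /=; lra.
ring.
Qed.

End RewardLaw.

Lemma meets_le (R : realType) (b : option rat) (x x' : \bar R) :
  (x <= x')%E -> Defs.meets b x -> Defs.meets b x'.
Proof. by case: b => //= c xx' /le_trans; apply. Qed.

(** Mean, CVaR and VaR are all monotone for first-order stochastic dominance, required here for each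
    coordinate separately. *)
Lemma satisfies_of_dominance (R : realType) (M : mdp R) (T : {set state M}) (d : nat)
    (r : state M -> 'I_d -> rat) (Q : query R d) (Mem : countType)
    (sigma : strategy M Mem) (P P' : probability (run M) R) :
  induced_measure sigma P' ->
  (forall j (f : R -> R), {homo f : x z / x <= z} ->
     fmean (fun t => ratr (r t j)) (hit_prob T P) f <=
     fmean (fun t => ratr (r t j)) (hit_prob T P') f) ->
  (forall j : 'I_d,
      let X : {RV P >-> R} := reward T r j in
      [/\ Defs.meets (q_exp Q j) ('E_P[X])%E,
          Defs.meets (q_cvar Q j) (CVaR X (q_p Q j)) &
          Defs.meets (q_var Q j) (VaR X (q_q Q j))%:E]) ->
  satisfies T r Q sigma.
Proof.
move=> indP' dom sat; exists P' => // j X'.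
have [se sc sv] := sat j.
have y0 := hit_prob_ge0 T P; have y1 := hit_prob_sum T P.
have y0' := hit_prob_ge0 T P'; have y1' := hit_prob_sum T P'.
split.
- apply: meets_le se; rewrite !expectation_reward lee_fin; exact: dom.
- apply: meets_le sc; rewrite !CVaR_reward lee_fin.
  have [p0 _] := andP (q_p01 Q j); apply: ler_wpM2l; first by rewrite invr_ge0 ltW.
  by apply: fcvar_dom => //; [exact: dom|exact: q_p01].
- apply: meets_le sv; rewrite !VaR_reward lee_fin.
  by apply: fvar_dom => //; [exact: dom|exact: q_q01].
Qed.

(** * Flows of a strategy *)

Lemma esumZl (R : realType) (X : choiceType) (I : set X) (c : R) (a : X -> \bar R) :
  0 <= c -> (forall x, 0 <= a x)%E ->
  (\esum_(x in I) (c%:E * a x) = c%:E * \esum_(x in I) a x)%E.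
Proof.
move=> c0 a0; rewrite /esum -ereal_supZl //; last first.
  by apply/set0P; exists 0%E, set0; [exact: fsets_set0|rewrite fsbig_set0].
congr ereal_sup; apply/seteqP; split=> x /=.
  move=> [A IA <-]; exists (\sum_(y \in A) a y)%E; first by exists A.
  by rewrite ge0_mule_fsumr.
by move=> [_ [A IA <-] <-]; exists A => //; rewrite ge0_mule_fsumr.
Qed.

Lemma esum_exchange (R : realType) (X Y : choiceType) (a : X -> Y -> \bar R) :
  (forall x y, 0 <= a x y)%E ->
  (\esum_(x in setT) \esum_(y in setT) a x y =
   \esum_(y in setT) \esum_(x in setT) a x y)%E.
Proof.
move=> a0; rewrite !esum_esum //.
rewrite (reindex_esum (setT `*`` (fun=> setT)) (setT `*`` (fun=> setT))
  (fun z : Y * X => (z.2, z.1))) //.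
by split=> [[y x] //|[y x] [y' x'] _ _ [-> ->]//|[x y] _]; exists (y, x).
Qed.

Lemma esum_finType (R : realType) (X : finType) (a : X -> \bar R) :
  (forall x, 0 <= a x)%E -> (\esum_(x in setT) a x = \sum_x a x)%E.
Proof.
move=> a0; have -> : [set: X] = [set` index_enum X].
  by apply/seteqP; split=> x //= _; rewrite mem_index_enum.
have finX : finite_set [set` index_enum X] by exact: finite_seq.
by rewrite esum_fset // [RHS]fsbig_seq // index_enum_uniq.
Qed.

Lemma distr_sum1 (R : realType) (X : finType) (D : distr R X) : \sum_x D x = 1.
Proof.
apply: EFin_inj; rewrite -sumEFin -esum_finType ?dprob_sum1 // => x.
by rewrite lee_fin dprob_ge0.
Qed.

Lemma Av_uniq (R : realType) (M : mdp R) (s s' : state M) (a : action M) :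
  a \in Av s -> a \in Av s' -> s = s'.
Proof.
move=> as_ as'; apply: (@Av_inj R M); apply/eqP.
have /and3P[_ /finset.trivIsetP triv _] := Av_partition M.
apply: contraT => ne.
have inP x : Av x \in [set Av s0 | s0 in state M]%SET by apply/imsetP; exists x.
by have /pred0P/(_ a) := triv _ _ (inP s) (inP s') ne; rewrite /= as_ as'.
Qed.

Section RunLaw.
Context (R : realType) (M : mdp R) (Mem : countType) (sigma : strategy M Mem).
Context (P : probability (run M) R) (indP : induced_measure sigma P).

Definition coord (n : nat) (rho : run M) : state M * action M := rho n.

Lemma measurable_coord n e : measurable (coord n @^-1` [set e]).
Proof. by apply: (@measurable_prefix _ _ n) => rho rho' h <- /=; rewrite /coord h. Qed.

Lemma prefix_prob_ge0 rho n m : (0 <= prefix_prob sigma rho n m)%E.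
Proof.
elim: n m => [|n IH] m /=; first by rewrite lee_fin !mulr_ge0 ?dprob_ge0.
apply: esum_ge0 => m' _; rewrite mule_ge0 ?IH // lee_fin.
by rewrite !mulr_ge0 ?dprob_ge0.
Qed.

Lemma eq_prefix_prob (rho rho' : run M) n m : (forall i, (i <= n)%N -> rho i = rho' i) ->
  prefix_prob sigma rho n m = prefix_prob sigma rho' n m.
Proof.
elim: n m => [|n IH] m e /=; first by rewrite e.
apply: eq_esum => m' _; rewrite IH; last by move=> i le_in; rewrite e // leqW.
by rewrite !e.
Qed.

Lemma pr_cylinder (rho : run M) n :
  (pr P (prefix_event coord rho n))%:E = (\esum_(m in setT) prefix_prob sigma rho n m)%E.
Proof.
rewrite -prE; last exact: (measurable_prefix_event measurable_coord).
exact: indP.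
Qed.

Lemma prefix_prob_fin (rho : run M) n m : prefix_prob sigma rho n m \is a fin_num.
Proof.
rewrite ge0_fin_numE ?prefix_prob_ge0 //.
apply: le_lt_trans (ltry (pr P (prefix_event coord rho n))); rewrite pr_cylinder.
apply: esum_ge; exists [set m]; first by split.
by rewrite fsbig_set1.
Qed.

(** The next state depends on the past only through the last action, whatever the hidden memory:
    summing out the next action and then the new memory leaves the factor [trans]. *)
Lemma run_step (rho : run M) n s' :
  pr P (prefix_event coord rho n `&` [set rho' | (rho' n.+1).1 = s']) =
  trans (rho n).2 s' * pr P (prefix_event coord rho n).
Proof.
have mB : measurable (prefix_event coord rho n `&` [set rho' : run M | (rho' n.+1).1 = s']).
  apply: (@measurable_prefix _ _ n.+1) => r r' e [/= h1 h2]; split=> /= [i le_in|].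
    by rewrite /coord -e ?leqW //; exact: h1.
  by rewrite -e.
rewrite (pr_partition P (f := fun r : run M => (r n.+1).2)) //; last first.
  by move=> a; apply: (@measurable_prefix _ _ n.+1) => r r' e /= <-; rewrite e.
pose h m m' := trans (rho n).2 s' * mem_update sigma (rho n).2 s' m m'.
have h0 m m' : 0 <= h m m' by rewrite mulr_ge0 ?dprob_ge0.
apply: EFin_inj; rewrite -sumEFin.
transitivity (\sum_a \esum_(m' in setT) \esum_(m in setT)
    (prefix_prob sigma rho n m * (h m m' * next_move sigma s' m' a)%:E))%E.
  apply: eq_bigr => a _.
  have -> : prefix_event coord rho n `&` [set r | (r n.+1).1 = s'] `&`
      (fun r : run M => (r n.+1).2) @^-1` [set a]
      = prefix_event coord (redirect rho n (s', a)) n.+1.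
    apply/seteqP; split=> r /=.
      move=> [[h1 h2] h3] i; rewrite leq_eqVlt => /orP[/eqP ->|].
        by rewrite /redirect ltnn /coord [r _]surjective_pairing h2 h3.
      by rewrite ltnS => le_in; rewrite /redirect le_in h1.
    move=> hr; have := hr n.+1 (leqnn _); rewrite /redirect ltnn /coord => ->.
    do 2![split] => //= i le_in.
    by have := hr i (leqW le_in); rewrite /redirect le_in.
  rewrite pr_cylinder; apply: eq_esum => m' _ /=; apply: eq_esum => m _.
  rewrite /redirect leqnn ltnn /= (@eq_prefix_prob _ rho) // => i le_in.
  by rewrite le_in.
rewrite -esum_sum => [|m' a _ _]; last first.
  by apply: esum_ge0 => m _; rewrite mule_ge0 ?prefix_prob_ge0 // lee_fin mulr_ge0 ?dprob_ge0.
transitivity (\esum_(m' in setT) \esum_(m in setT)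
    (prefix_prob sigma rho n m * (h m m')%:E))%E.
  apply: eq_esum => m' _; rewrite -esum_sum => [|m a _ _]; last first.
    by rewrite mule_ge0 ?prefix_prob_ge0 // lee_fin mulr_ge0 ?dprob_ge0.
  apply: eq_esum => m _; rewrite -(fineK (prefix_prob_fin rho n m)).
  under eq_bigr do rewrite -EFinM mulrA.
  by rewrite sumEFin -mulr_sumr distr_sum1 mulr1 EFinM.
rewrite esum_exchange => [|m m']; last by rewrite mule_ge0 ?prefix_prob_ge0 // lee_fin.
rewrite EFinM pr_cylinder -esumZl ?dprob_ge0 //; last by move=> m; exact: prefix_prob_ge0.
apply: eq_esum => m _; have f0 := fine_ge0 (prefix_prob_ge0 rho n m).
rewrite -(fineK (prefix_prob_fin rho n m)) -EFinM.
under eq_esum do rewrite -EFinM mulrA [_ * trans _ _]mulrC EFinM.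
rewrite esumZl ?mulr_ge0 ?dprob_ge0 ?dprob_sum1 ?mule1 // => m'.
by rewrite lee_fin dprob_ge0.
Qed.

Lemma next_move0 s m a : a \notin Av s -> next_move sigma s m a = 0.
Proof.
move=> aAv; apply: le_anti; rewrite dprob_ge0 andbT leNgt.
by apply: contra aAv; exact: next_move_Av.
Qed.

Lemma run_Av (rho : run M) n : (rho n).2 \notin Av (rho n).1 ->
  pr P (prefix_event coord rho n) = 0.
Proof.
move=> aAv; apply: EFin_inj; rewrite (pr_cylinder rho n) esum1 // => m _.
case: n aAv => [|n] aAv /=; first by rewrite next_move0 ?mulr0.
by rewrite esum1 // => m' _; rewrite next_move0 // mulr0 mule0.
Qed.

Lemma run_init s : pr P [set rho | (rho 0%N).1 = s] = (s == init M)%:R.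
Proof.
rewrite (pr_partition P (f := fun r : run M => (r 0%N).2)) //; last 2 first.
- by move=> a; apply: (@measurable_prefix _ _ 0) => r r' e /= <-; rewrite e.
- by apply: (@measurable_prefix _ _ 0) => r r' e /= <-; rewrite e.
apply: EFin_inj; rewrite -sumEFin.
transitivity (\sum_a \esum_(m in setT)
    ((s == init M)%:R * init_mem sigma m * next_move sigma s m a)%:E)%E.
  apply: eq_bigr => a _.
  have -> : [set r : run M | (r 0%N).1 = s] `&` (fun r : run M => (r 0%N).2) @^-1` [set a]
      = prefix_event coord (fun=> (s, a)) 0.
    apply/seteqP; split=> r /=.
      by move=> [h1 h2] i; rewrite leqn0 => /eqP ->; rewrite /coord [r _]surjective_pairing h1 h2.
    by move=> hr; have := hr 0%N isT; rewrite /coord => ->.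
  by rewrite pr_cylinder.
rewrite -esum_sum => [|m a _ _]; last by rewrite lee_fin !mulr_ge0 ?dprob_ge0.
under eq_esum do rewrite sumEFin -mulr_sumr distr_sum1 mulr1 EFinM.
rewrite esumZl ?dprob_sum1 ?mule1 // => m; by rewrite lee_fin dprob_ge0.
Qed.

End RunLaw.

Section RunFlow.
Context (R : realType) (M : mdp R) (Mem : countType) (sigma : strategy M Mem).
Context (P : probability (run M) R) (indP : induced_measure sigma P).
Context (T : {set state M}).

Let before (k : nat) (rho : nat -> state M * action M) : Prop :=
  forall i, (i < k)%N -> (rho i).1 \notin T.

(** The state at time [k] may itself be a target here, but not in [playQ]: targets receive flow and
    emit none. *)
Let arriveQ k s (rho : nat -> state M * action M) : Prop := (rho k).1 = s /\ before k rho.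

Let playQ k a (rho : nat -> state M * action M) : Prop := (rho k).2 = a /\ before k.+1 rho.

Definition arrive (k : nat) (s : state M) : R := pr P (path_event (@coord R M) (arriveQ k s)).

Definition play (k : nat) (a : action M) : R := pr P (path_event (@coord R M) (playQ k a)).

Let dep_arriveQ k s : prefix_dep k (arriveQ k s).
Proof.
by move=> r r' e [<- h]; split=> [|i ik]; rewrite -e //; [exact: h|exact: ltnW].
Qed.

Let dep_playQ k a : prefix_dep k (playQ k a).
Proof. by move=> r r' e [<- h]; split=> [|i ik]; rewrite -e //; exact: h. Qed.

Let mcoord := @measurable_coord R M.

Lemma pr_path_eventT k Q : prefix_dep k Q ->
  (forall rho, Q rho -> pr P (prefix_event (@coord R M) rho k) = 0) ->
  pr P (path_event (@coord R M) Q) = 0.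
Proof.
move=> dQ Q0; rewrite -(setIT (path_event _ Q)).
rewrite (pr_path_event_condition mcoord (c := 0) dQ measurableT) ?mul0r // => rho Qrho.
by rewrite setIT mul0r; exact: Q0.
Qed.

Lemma pr_not_Av k Q : prefix_dep k Q ->
  (forall rho, Q rho -> (rho k).2 \notin Av (rho k).1) ->
  pr P (path_event (@coord R M) Q) = 0.
Proof. by move=> dQ QAv; apply: pr_path_eventT dQ _ => rho /QAv; exact: run_Av. Qed.

Let measurable_proj (F : finType) (f : state M * action M -> F) k x :
  measurable ((fun rho : run M => f (rho k)) @^-1` [set x]).
Proof. by apply: (@measurable_prefix _ _ k) => r r' e /= <-; rewrite e. Qed.

Lemma arrive_ge0 k s : 0 <= arrive k s. Proof. exact: pr_ge0. Qed.

Lemma play_ge0 k a : 0 <= play k a. Proof. exact: pr_ge0. Qed.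

Lemma arrive0 s : arrive 0 s = (s == init M)%:R.
Proof.
rewrite -(run_init indP) /arrive; congr pr; apply/seteqP.
by split=> r /= => [[]//|h]; split.
Qed.

Lemma arriveS k s : arrive k.+1 s = \sum_a play k a * trans a s.
Proof.
have mQ k' Q (dQ : prefix_dep k' Q) := measurable_path_event mcoord dQ.
rewrite /arrive (pr_partition P (measurable_proj snd k)); last exact: mQ (@dep_arriveQ k.+1 s).
apply: eq_bigr => a _; rewrite mulrC.
rewrite -(pr_path_event_condition mcoord (@dep_playQ k a) (measurable_proj fst k.+1 s)).
  congr pr; apply/seteqP; split=> r /=; first by move=> [[h1 h2] h3].
  by move=> [[h1 h2] h3].
by move=> rho [<- _]; exact: (run_step indP).
Qed.

Lemma play_Av_T k a s : s \in T -> a \in Av s -> play k a = 0.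
Proof.
move=> sT aAv; apply: (pr_not_Av (@dep_playQ k a)) => rho [ra rT].
rewrite ra; apply: contraL (rT k (leqnn _)) => aAv'.
by rewrite negbK -(Av_uniq aAv aAv').
Qed.

(** Each action is available in one state only, so almost surely the action played determines the
    state. *)
Lemma arrive_play k s : s \notin T -> arrive k s = \sum_(a in Av s) play k a.
Proof.
move=> sT; have mQ k' Q (dQ : prefix_dep k' Q) := measurable_path_event mcoord dQ.
rewrite /arrive (pr_partition P (measurable_proj snd k)); last first.
  exact: mQ (@dep_arriveQ k s).
rewrite [RHS]big_mkcond; apply: eq_bigr => a _.
pose Q s' (rho : nat -> state M * action M) := playQ k a rho /\ (rho k).1 = s'.
have dQ s' : prefix_dep k (Q s').
  by move=> r r' e [/(dep_playQ e) h <-]; split=> //; rewrite e.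
have -> : path_event (@coord R M) (arriveQ k s) `&` (fun rho : run M => (rho k).2) @^-1` [set a] =
    path_event (@coord R M) (Q s).
  apply/seteqP; split=> r /=.
    move=> [[h1 h2] h3]; split=> //; split=> // i; rewrite ltnS leq_eqVlt.
    by case/orP => [/eqP ->|/h2 //]; rewrite h1.
  by move=> [[h1 h2] h3]; split=> //; split=> // i ik; apply: h2; exact: ltnW.
case: ifPn => aAv; last first.
  by apply: (pr_not_Av (dQ s)) => rho [[-> _] ->].
rewrite /play [RHS](pr_partition P (measurable_proj fst k)); last exact: mQ (@dep_playQ k a).
rewrite (bigD1 s) //= big1 ?addr0 // => s' s's.
apply: (pr_not_Av (dQ s')) => rho [[-> _] ->].
by apply: contra s's => aAv'; rewrite (Av_uniq aAv aAv').
Qed.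

End RunFlow.

Lemma hit_prob_cvg (R : realType) (M : mdp R) (P : probability (run M) R)
    (T : {set state M}) t : t \in T ->
  \sum_(k < n) arrive P T k t @[n --> \oo] --> hit_prob T P t.
Proof.
move=> tT.
have arr k : hit_at T t k = path_event (@coord R M)
    (fun rho => (rho k).1 = t /\ forall i, (i < k)%N -> (rho i).1 \notin T).
  by apply/seteqP; split=> r /= => [[_ h1 h2]|[h1 h2]].
have : (\sum_(0 <= k < n) P (hit_at T t k))%E @[n --> \oo] --> P (hit T t).
  apply: (@measure_semi_sigma_additive _ _ _ P (hit_at T t)).
  - exact: measurable_hit_at.
  - exact: trivIset_hit_at.
  - exact: measurable_hit.
have -> : P (hit T t) = (hit_prob T P t)%:E by exact: prE (measurable_hit T t).
move=> /fine_cvg; apply: cvg_trans.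
apply: near_eq_cvg; apply: nearW => n /=; rewrite big_mkord.
rewrite (eq_bigr (fun k : 'I_n => (arrive P T k t)%:E)) ?sumEFin // => k _.
by rewrite [LHS](prE P (measurable_hit_at T t k)) arr.
Qed.

(* [x a]: expected number of uses of the action [a] before [T] is reached;
   [z s]: probability of stopping in [s] to stay in the trap [U] for ever. *)
Record occupation (R : realType) (M : mdp R) (T U : {set state M})
    (x : action M -> R) (z y : state M -> R) : Prop := Occupation {
  occ_x_ge0 : forall a, 0 <= x a;
  occ_z_ge0 : forall s, 0 <= z s;
  occ_x_T : forall s a, s \in T -> a \in Av s -> x a = 0;
  occ_z_U : forall s, s \notin U -> z s = 0;
  occ_balance : forall s, s \notin T ->
    \sum_(a in Av s) x a + z s = (s == init M)%:R + \sum_a x a * trans a s;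
  occ_target : forall t, t \in T ->
    y t = (t == init M)%:R + \sum_a x a * trans a t;
  occ_U_T : forall s, s \in U -> s \notin T;
  occ_U_trap : forall s, s \in U -> exists2 a, a \in Av s &
    forall s', 0 < trans a s' -> s' \in U
}.

(** * From the flows of a strategy to a finite occupation measure *)

Section OccupationExists.
Context (R : realType) (M : mdp R) (T : {set state M}).
Context (alpha : nat -> state M -> R) (beta : nat -> action M -> R) (y : state M -> R).
Hypotheses (alpha_ge0 : forall k s, 0 <= alpha k s) (beta_ge0 : forall k a, 0 <= beta k a).
Hypothesis alpha0 : forall s, alpha 0 s = (s == init M)%:R.
Hypothesis alphaS : forall k s, alpha k.+1 s = \sum_a beta k a * trans a s.
Hypothesis beta_T : forall k a s, s \in T -> a \in Av s -> beta k a = 0.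
Hypothesis alpha_beta : forall k s, s \notin T -> alpha k s = \sum_(a in Av s) beta k a.
Hypothesis alpha_y : forall t, t \in T ->
  \sum_(k < n) alpha k t @[n --> \oo] --> y t.

(* The flow through each action that may leave [recurring] tends to 0, so every state of
   [recurring] has another action, which surely stays in [recurring]. *)
Definition recurring : {set state M} :=
  [set s | `[< ~ (alpha k s @[k --> \oo] --> (0 : R)) >]]%SET.

Lemma not_recurring s : s \notin recurring -> alpha k s @[k --> \oo] --> (0 : R).
Proof. by rewrite inE => /asboolPn/contrapT. Qed.

(** The arrivals at a target are summable, hence tend to 0. *)
Lemma recurring_T s : s \in recurring -> s \notin T.
Proof.
rewrite inE => /asboolP nc; apply/negP => /alpha_y cy; apply: nc.
apply: cvg_series_cvg_0; apply/cvg_ex; exists (y s).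
apply: cvg_trans cy; apply: near_eq_cvg; apply: nearW => n.
by rewrite /series /= big_mkord.
Qed.

Lemma recurring_trap s : s \in recurring -> exists2 a, a \in Av s &
  forall s', 0 < trans a s' -> s' \in recurring.
Proof.
move=> sU; have sT := recurring_T sU; move: sU; rewrite inE => /asboolP.
apply: contra_notP => noa.
suff : \sum_(a in Av s) beta k a @[k --> \oo] --> \sum_(a in Av s) (0 : R).
  by rewrite big1 //; under eq_cvg do rewrite -(alpha_beta _ sT).
apply: cvg_sumr => a aAv.
have [s' tr s'U] : exists2 s', 0 < trans a s' & s' \notin recurring.
  apply: contra_notP noa => no; exists a => // s' tr; apply/negPn/negP => s'U.
  by apply: no; exists s'.
(* A fraction [trans a s'] of the flow through [a] arrives at [s'], so [beta k a] is at most this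
   quotient. *)
have c1 : (alpha k.+1 s' / trans a s') @[k --> \oo] --> (0 : R).
  rewrite -[X in _ --> X](mul0r (trans a s')^-1).
  apply: cvgM; last exact: cvg_cst.
  by have := not_recurring s'U; rewrite -cvg_shiftS.
apply: (squeeze_cvgr _ (cvg_cst 0) c1); apply: nearW => k.
rewrite beta_ge0 /= ler_pdivlMr // alphaS (bigD1 a) //= lerDl.
by apply: sumr_ge0 => a' _; rewrite mulr_ge0 ?dprob_ge0.
Qed.

Let inT (a : action M) : bool := [exists s in T, a \in Av s].

Let inTP a : reflect (exists2 s, s \in T & a \in Av s) (inT a).
Proof.
by apply: (iffP existsP) => [[s /andP[? ?]]|[s ? ?]]; exists s => //; apply/andP.
Qed.

(** Generators of the cone: a use of [a] feeds its successors and consumes one unit at its own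
    state; a leak consumes one unit at a recurring state. *)
Let coeff (g : action M + state M) (s : state M) : R :=
  match g with
  | inl a => if inT a then 0 else trans a s - ((s \notin T) && (a \in Av s))%:R
  | inr s' => - ((s' \in recurring) && (s == s'))%:R
  end.

Let sum_coeff (x : action M -> R) (z : state M -> R) s :
  (forall a, inT a -> x a = 0) ->
  \sum_g (match g with inl a => x a | inr s' => z s' end) * coeff g s =
  \sum_a x a * trans a s - (if s \notin T then \sum_(a in Av s) x a else 0)
   - (if s \in recurring then z s else 0).
Proof.
move=> x0; rewrite big_sumType /=; congr (_ + _); last first.
  rewrite (bigD1 s) //= big1 ?addr0 => [|s' s's].
    by rewrite eqxx andbT; case: ifP => _; rewrite ?mulrN1 ?oppr0 ?mulr0.
  by rewrite eq_sym (negbTE s's) andbF oppr0 mulr0.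
rewrite (_ : (if _ then _ else _) = \sum_a x a * ((s \notin T) && (a \in Av s))%:R).
  rewrite -sumrB; apply: eq_bigr => a _; case: ifP => [/x0 ->|_]; first by rewrite !mul0r subr0.
  by rewrite mulrBr.
case: ifP => _ /=; last by rewrite big1 // => a _; rewrite mulr0.
by rewrite big_mkcond; apply: eq_bigr => a _; case: ifP => _; rewrite ?mulr1 ?mulr0.
Qed.

Lemma occupation_exists : exists U x z, occupation T U x z y.
Proof.
pose b s : R := (if s \in T then y s else 0) - (s == init M)%:R.
pose b_ n s : R := \sum_g (match g with
  | inl a => \sum_(k < n) beta k a | inr s' => alpha n s' end) * coeff g s.
have [n|s|w w0 wb] := finite_cone_closed (A := coeff) (b_ := b_) (b := b).
- exists (fun g => match g with
    | inl a => \sum_(k < n) beta k a | inr s' => alpha n s' end) => // -[a|s] //.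
  by rewrite sumr_ge0.
(* Outside [T], arrivals at times 1 to [n] minus departures at times 0 to [n - 1] telescope to
   [alpha n s] minus the initial mass; in [recurring] the leak cancels [alpha n s]. *)
- have bE n : b_ n s = (if s \in T then \sum_(k < n.+1) alpha k s else
      if s \in recurring then 0 else alpha n s) - (s == init M)%:R.
    rewrite /b_ sum_coeff; last first.
      by move=> a /inTP[s' s'T aAv]; rewrite big1 // => k _; exact: beta_T s'T aAv.
    have -> : \sum_a (\sum_(k < n) beta k a) * trans a s = \sum_(k < n) alpha k.+1 s.
      rewrite (eq_bigr (fun a => \sum_(k < n) beta k a * trans a s)).
        by rewrite exchange_big; apply: eq_bigr => k _; rewrite alphaS.
      by move=> a _; rewrite mulr_suml.
    have -> : \sum_(k < n) alpha k.+1 s = \sum_(k < n.+1) alpha k s - (s == init M)%:R.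
      by rewrite big_ord_recl alpha0 addrC addKr.
    have [sT|sT] := boolP (s \in T) => /=.
      rewrite ifF ?subr0 //; apply/negP => /recurring_T; by rewrite sT.
    rewrite exchange_big (eq_bigr (fun k : 'I_n => alpha k s)); last first.
      by move=> k _; rewrite alpha_beta.
    by rewrite big_ord_recr /=; case: ifP => _; ring.
  under eq_cvg do rewrite bE.
  rewrite /b; apply: cvgB; last exact: cvg_cst.
  case: ifP => sT; first by have := alpha_y sT; rewrite -cvg_shiftS.
  have [_|sU] := boolP (s \in recurring); first exact: cvg_cst.
  exact: not_recurring.
(* The generators of actions in [T] and of nonrecurring states vanish, so [w] is arbitrary there and
   is reset to 0. *)
pose x a := if inT a then 0 else w (inl a).
pose z s := if s \in recurring then w (inr s) else 0.
have xT a : inT a -> x a = 0 by rewrite /x => ->.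
have xzb s : \sum_a x a * trans a s - (if s \notin T then \sum_(a in Av s) x a else 0)
   - z s = b s.
  rewrite -wb; transitivity (\sum_a x a * trans a s -
      (if s \notin T then \sum_(a in Av s) x a else 0) -
      (if s \in recurring then z s else 0)).
    by rewrite /z; case: (s \in recurring).
  rewrite -sum_coeff //; apply: eq_bigr => -[a|s'] _ /=.
    by rewrite /x; case: ifP => _; rewrite ?mulr0.
  by rewrite /z; case: ifP => _ //=; rewrite oppr0 !mulr0.
exists recurring, x, z; split.
- by move=> a; rewrite /x; case: ifP.
- by move=> s; rewrite /z; case: ifP.
- by move=> s a sT aAv; apply: xT; apply/inTP; exists s.
- by move=> s sU; rewrite /z (negbTE sU).
- by move=> s sT; have := xzb s; rewrite /b sT (negbTE sT) => h; lra.
- move=> t tT; have := xzb t; rewrite /b tT /= /z ifF; first by move=> h; lra.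
  by apply/negP => /recurring_T; rewrite tT.
- exact: recurring_T.
- exact: recurring_trap.
Qed.

End OccupationExists.

(** * Finite-memory strategies *)

Section FiniteMemory.
Context (R : realType) (M : mdp R) (Mem : finType) (sigma : strategy M Mem).
Context (T : {set state M}).

Local Notation E := (state M * Mem * action M)%type.

Lemma chain_init_ge0 (e : E) : 0 <= chain_init sigma e.
Proof. by case: e => [[s m] a]; rewrite !mulr_ge0 ?dprob_ge0. Qed.

Lemma chain_step_ge0 (e e' : E) : 0 <= chain_step sigma e e'.
Proof. by case: e => [[s m] a]; case: e' => [[s' m'] a']; rewrite !mulr_ge0 ?dprob_ge0. Qed.

Lemma sum_triple (f : E -> R) : \sum_e f e = \sum_s \sum_m \sum_a f (s, m, a).
Proof.
by rewrite pair_bigA pair_bigA; apply: eq_bigr => -[[s m] a].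
Qed.

Lemma chain_init_sum1 : \sum_e chain_init sigma e = 1.
Proof.
rewrite sum_triple (bigD1 (init M)) //= [X in _ + X]big1 ?addr0.
  rewrite -[RHS](distr_sum1 (init_mem sigma)); apply: eq_bigr => m _.
  by rewrite -mulr_sumr distr_sum1 eqxx mul1r mulr1.
move=> s /negbTE s_init; rewrite big1 // => m _; rewrite big1 // => a _.
by rewrite s_init !mul0r.
Qed.

Lemma chain_step_sum (e : E) s' m' :
  \sum_a' chain_step sigma e (s', m', a') =
  trans e.2 s' * mem_update sigma e.2 s' e.1.2 m'.
Proof. by case: e => [[s m] a] /=; rewrite -mulr_sumr distr_sum1 mulr1. Qed.

Lemma chain_step_sum1 (e : E) : \sum_e' chain_step sigma e e' = 1.
Proof.
rewrite sum_triple -[RHS](distr_sum1 (trans e.2)); apply: eq_bigr => s' _.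
rewrite -[RHS]mulr1 -[in RHS](distr_sum1 (mem_update sigma e.2 s' e.1.2)) mulr_sumr.
by apply: eq_bigr => m' _; exact: chain_step_sum.
Qed.

Context (e0 : E).

Let Z : nat -> measurableTypeR R -> E :=
  chain_path e0 (chain_init sigma) (chain_step sigma).

Let mZ : forall n e, measurable (Z n @^-1` [set e]).
Proof.
move=> n e; apply: measurable_chain_path.
- exact: chain_init_ge0.
- exact: chain_init_sum1.
- exact: chain_step_ge0.
- exact: chain_step_sum1.
Qed.

Let U : probability (measurableTypeR R) R := @unit_measure R.

Let prZ rho n : pr U (prefix_event Z rho n) =
  path_mass (chain_init sigma) (chain_step sigma) rho n.
Proof.
apply: EFin_inj; rewrite -prE; last exact: measurable_prefix_event.
apply: chain_prefix_prob.
- exact: chain_init_ge0.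
- exact: chain_init_sum1.
- exact: chain_step_ge0.
- exact: chain_step_sum1.
Qed.

Let markov n Q e e' : prefix_dep n Q -> (forall rho, Q rho -> rho n = e) ->
  pr U (path_event Z Q `&` Z n.+1 @^-1` [set e']) =
  chain_step sigma e e' * pr U (path_event Z Q).
Proof.
move=> dQ Qe; apply: (pr_path_event_condition mZ dQ (mZ n.+1 e')) => rho /Qe rho_n.
have -> : prefix_event Z rho n `&` Z n.+1 @^-1` [set e'] =
    prefix_event Z (redirect rho n e') n.+1.
  apply/seteqP; split=> u /=.
    move=> [h1 h2] i; rewrite leq_eqVlt => /orP[/eqP ->|]; first by rewrite /redirect ltnn.
    by rewrite ltnS => le_in; rewrite /redirect le_in h1.
  move=> h; split; last by have := h n.+1 (leqnn _); rewrite /redirect ltnn.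
  by move=> i le_in; have := h i (leqW le_in); rewrite /redirect le_in.
rewrite !prZ /= /redirect leqnn ltnn rho_n mulrC; congr (_ * _).
by apply: eq_path_mass => i ->.
Qed.

Definition run_of (u : measurableTypeR R) : run M := fun n => ((Z n u).1.1, (Z n u).2).

Let mpath n Q (dQ : prefix_dep n Q) : measurable (path_event Z Q) :=
  measurable_path_event mZ dQ.

Let shadow (rho : run M) n (h : nat -> E) : Prop :=
  forall i, (i <= n)%N -> ((h i).1.1, (h i).2) = rho i.

Let dep_shadow rho n : prefix_dep n (shadow rho n).
Proof. by move=> h h' e hs i le_in; rewrite -e // hs. Qed.

Lemma measurable_run_of : measurable_fun setT (run_of : measurableTypeR R -> run M).
Proof.
apply: (@measurability _ _ _ (run M) setT run_of (@cylinders R M)) => // _ [_ [rho [n ->]] <-].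
rewrite setTI; exact: mpath (@dep_shadow rho n).
Qed.

HB.instance Definition _ :=
  isMeasurableFun.Build _ _ (measurableTypeR R) (run M) run_of measurable_run_of.

Definition run_prob : probability (run M) R := distribution U run_of.

Let measurable_proj (F : finType) (f : E -> F) k x :
  measurable ((fun u => f (Z k u)) @^-1` [set x]).
Proof.
apply: (@mpath k (fun h => f (h k) = x)) => h h' e <-; by rewrite e.
Qed.

(** Recording the memory at time [n] together with the visible prefix fixes the full state of the
    chain, so [markov] applies to each memory value. *)
Let pr_shadow rho n m :
  (pr U (path_event Z (fun h => shadow rho n h /\ (h n).1.2 = m)))%:E =
  prefix_prob sigma rho n m.
Proof.
elim: n m => [|n IH] m.
  have -> : path_event Z (fun h => shadow rho 0 h /\ (h 0%N).1.2 = m) =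
      prefix_event Z (fun=> ((rho 0%N).1, m, (rho 0%N).2)) 0.
    apply/seteqP; split=> u /=.
      move=> [/(_ 0%N isT) <- <-] i; rewrite leqn0 => /eqP -> /=.
      by case: (Z 0 u) => [[]].
    move=> h; have h0 := h 0%N isT; split; last by rewrite h0.
    by move=> i; rewrite leqn0 => /eqP ->; rewrite h0; case: (rho 0%N).
  by rewrite prZ.
set e' := ((rho n.+1).1, m, (rho n.+1).2).
have -> : path_event Z (fun h => shadow rho n.+1 h /\ (h n.+1).1.2 = m) =
    path_event Z (shadow rho n) `&` Z n.+1 @^-1` [set e'].
  apply/seteqP; split=> u /=.
    move=> [h hm]; split; first by move=> i le_in; apply: h; exact: leqW.
    rewrite /e' -(h n.+1 (leqnn _)) -hm /=; by case: (Z n.+1 u) => [[]].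
  move=> [h hZ]; split; last by rewrite hZ.
  move=> i; rewrite leq_eqVlt => /orP[/eqP ->|]; last by rewrite ltnS; exact: h.
  by rewrite hZ /e' /=; case: (rho n.+1).
rewrite (pr_partition U (measurable_proj (fun e => e.1.2) n)); last first.
  by apply: measurableI; [exact: mpath (@dep_shadow rho n)|exact: mZ].
rewrite -sumEFin /= esum_finType; last first.
  move=> m'; rewrite mule_ge0 ?prefix_prob_ge0 // lee_fin.
  by rewrite !mulr_ge0 ?dprob_ge0.
apply: eq_bigr => m' _; rewrite -IH -EFinM mulrC.
pose Q h := shadow rho n h /\ (h n).1.2 = m'.
have dQ : prefix_dep n Q.
  by move=> h h' e [hs hm]; split; [exact: dep_shadow hs|rewrite -e].
have Qe h : Q h -> h n = ((rho n).1, m', (rho n).2).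
  by move=> [/(_ n (leqnn _)) <- <-] /=; case: (h n) => [[]].
rewrite -[X in X * _]/(chain_step sigma ((rho n).1, m', (rho n).2) e') -(markov e' dQ Qe).
by congr (pr _ _)%:E; apply/seteqP; split=> u /= => [[[h1 h2] h3]|[[h1 h2] h3]].
Qed.

Lemma run_prob_induced : induced_measure sigma run_prob.
Proof.
move=> rho n; rewrite esum_finType => [|m]; last exact: prefix_prob_ge0.
have -> : run_prob (cylinder rho n) = U (path_event Z (shadow rho n)) by [].
rewrite prE; last exact: mpath (@dep_shadow rho n).
rewrite (pr_partition U (measurable_proj (fun e => e.1.2) n)); last first.
  exact: mpath (@dep_shadow rho n).
by rewrite -sumEFin; apply: eq_bigr => m _; rewrite -pr_shadow.
Qed.

(* Probability of reaching the state [s] at time [k] with memory [m], not having been in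
   [T] before. *)
Fixpoint memory_flow (k : nat) (s' : state M) (m' : Mem) : R :=
  if k is k'.+1 then
    \sum_(s | s \notin T) \sum_m memory_flow k' s m *
      \sum_a next_move sigma s m a * trans a s' * mem_update sigma a s' m m'
  else (s' == init M)%:R * init_mem sigma m'.

Let before (k : nat) (h : nat -> E) : Prop := forall i, (i < k)%N -> (h i).1.1 \notin T.

Let reachQ k (e : E) h : Prop := h k = e /\ before k h.

Let dep_reachQ k e : prefix_dep k (reachQ k e).
Proof.
by move=> h h' ee [<- hb]; split=> [|i ik]; rewrite -ee //; [exact: hb|exact: ltnW].
Qed.

(** The action at time [k] is drawn from [s] and [m] alone, so the law of the triple factorises and
    the flow need not record actions. *)
Let pr_reach k s m a :
  pr U (path_event Z (reachQ k (s, m, a))) = memory_flow k s m * next_move sigma s m a.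
Proof.
elim: k s m a => [|k IH] s' m' a'.
  rewrite -[RHS]/(path_mass (chain_init sigma) (chain_step sigma) (fun=> (s', m', a')) 0).
  rewrite -prZ; congr pr; apply/seteqP; split=> u /=.
    by move=> [h _] i; rewrite leqn0 => /eqP ->.
  by move=> /(_ 0%N isT) h; split.
rewrite (pr_partition U (mZ k)); last exact: mpath (@dep_reachQ k.+1 _).
rewrite sum_triple /= [in RHS]big_mkcond mulr_suml; apply: eq_bigr => s _.
case: ifPn => sT; last first.
  rewrite mul0r big1 // => m _; rewrite big1 // => a _.
  rewrite [X in pr _ X](_ : _ = set0) ?/pr ?measure0 //.
  apply/seteqP; split=> // u [[_ h] hZ]; have := h k (leqnn _).
  by rewrite hZ /= (negbTE sT).
rewrite mulr_suml; apply: eq_bigr => m _.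
rewrite mulr_sumr mulr_suml; apply: eq_bigr => a _.
have -> : path_event Z (reachQ k.+1 (s', m', a')) `&` Z k @^-1` [set (s, m, a)] =
    path_event Z (reachQ k (s, m, a)) `&` Z k.+1 @^-1` [set (s', m', a')].
  apply/seteqP; split=> u /=.
    move=> [[h1 h2] h3]; split=> //; split=> // i ik; apply: h2; exact: ltnW.
  move=> [[h1 h2] h3]; split=> //; split=> // i; rewrite ltnS leq_eqVlt.
  by case/orP => [/eqP ->|/h2 //]; rewrite h1.
rewrite (markov (s', m', a') (@dep_reachQ k (s, m, a)) (e := (s, m, a))); last by move=> h [].
by rewrite IH /=; ring.
Qed.

Lemma arrive_run_prob k s : arrive run_prob T k s = \sum_m memory_flow k s m.
Proof.
pose Q h := (h k).1.1 = s /\ before k h.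
have dQ : prefix_dep k Q.
  by move=> h h' ee [hs hb]; split=> [|i ik]; rewrite -ee //; [exact: hb|exact: ltnW].
have -> : arrive run_prob T k s = pr U (path_event Z Q) by [].
rewrite (pr_partition U (mZ k)); last exact: mpath dQ.
rewrite sum_triple (bigD1 s) //= [X in _ + X]big1 ?addr0 => [|s' s's]; last first.
  rewrite big1 // => m _; rewrite big1 // => a _.
  rewrite [X in pr _ X](_ : _ = set0) ?/pr ?measure0 //.
  apply/seteqP; split=> // u [[h _] hZ]; move: s's.
  by rewrite -h hZ /= eqxx.
apply: eq_bigr => m _; rewrite -[RHS]mulr1 -[in RHS](distr_sum1 (next_move sigma s m)).
rewrite mulr_sumr; apply: eq_bigr => a _; rewrite -pr_reach; congr pr.
apply/seteqP; split=> u /= => [[[h1 h2] h3]|[h1 h2]] //.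
by split=> //; split=> //; rewrite h1.
Qed.

End FiniteMemory.

Lemma finite_memory_run (R : realType) (M : mdp R) (Mem : finType)
    (sigma : strategy M Mem) (T : {set state M}) :
  exists2 P : probability (run M) R, induced_measure sigma P &
    forall k s, arrive P T k s = \sum_m memory_flow sigma T k s m.
Proof.
(* The default value for [select] exists because the initial probabilities sum to 1. *)
have [e0 _] : exists e : state M * Mem * action M, True.
  apply: contrapT => noe; have := chain_init_sum1 sigma.
  rewrite big1 => [/eqP|e _]; first by rewrite eq_sym oner_eq0.
  by case: noe; exists e.
exists (run_prob sigma e0); first exact: run_prob_induced.
exact: arrive_run_prob.
Qed.

Definition fin_distr (R : realType) (X : finType) (f : X -> R)
    (f_ge0 : forall x, 0 <= f x) (f_sum1 : \sum_x f x = 1) : distr R X :=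
  @Distr R X f f_ge0
    (etrans (esum_finType (fun x => f_ge0 x : (0 <= (f x)%:E)%E))
      (etrans (sumEFin _ _ _) (congr1 EFin f_sum1))).

Lemma point_sum1 (R : realType) (X : finType) (x0 : X) :
  \sum_x (x == x0)%:R = 1 :> R.
Proof. by rewrite (bigD1 x0) //= eqxx big1 ?addr0 // => x /negbTE ->. Qed.

Definition point_distr (R : realType) (X : finType) (x0 : X) : distr R X :=
  @fin_distr R X (fun x => (x == x0)%:R) (fun x => ler0n R _) (point_sum1 R x0).

Section Coin.
Context (R : realType) (p : R) (p01 : 0 <= p <= 1).

Let coin (m : 'I_2) : R := if m == ord0 then p else 1 - p.

Let coin_ge0 m : 0 <= coin m.
Proof. by have /andP[p0 p1] := p01; rewrite /coin; case: ifP => _ //; rewrite subr_ge0. Qed.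

Let coin_sum1 : \sum_m coin m = 1.
Proof. by rewrite !big_ord_recl big_ord0 /coin /= addr0 subrKC. Qed.

Definition coin_distr : distr R 'I_2 := fin_distr coin_ge0 coin_sum1.

End Coin.

(** * Strategies that follow an occupation measure *)

Section OccupationStrategies.
Context (R : realType) (M : mdp R) (T U : {set state M}).
Context (x : action M -> R) (z y : state M -> R) (occ : occupation T U x z y).

Let visits (s : state M) : R := \sum_(a in Av s) x a.

Let visits_ge0 s : 0 <= visits s.
Proof. by apply: sumr_ge0 => a _; exact: occ_x_ge0 occ a. Qed.

Let base_prob (s : state M) (a : action M) : R :=
  if visits s == 0 then (a == xchoose (Av_neq0 s))%:R
  else if a \in Av s then x a / visits s else 0.

Let base_prob_ge0 s a : 0 <= base_prob s a.
Proof.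
rewrite /base_prob; case: ifP => // _; case: ifP => // _.
by rewrite divr_ge0 //; exact: occ_x_ge0 occ a.
Qed.

Let base_prob_sum1 s : \sum_a base_prob s a = 1.
Proof.
rewrite /base_prob; case: (eqVneq (visits s) 0) => v0; first exact: point_sum1.
by rewrite -big_mkcond -mulr_suml divff.
Qed.

Definition base_move (s : state M) : distr R (action M) :=
  fin_distr (base_prob_ge0 s) (base_prob_sum1 s).

Lemma base_move_Av s a : 0 < base_move s a -> a \in Av s.
Proof.
rewrite /= /base_prob; case: ifP => _; last by case: ifP => //; rewrite ltxx.
by case: eqP => [-> _|_]; [exact: xchooseP|rewrite ltxx].
Qed.

Definition base_trans (s s' : state M) : R := \sum_a base_move s a * trans a s'.

Lemma base_trans_ge0 s s' : 0 <= base_trans s s'.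
Proof. by apply: sumr_ge0 => a _; rewrite mulr_ge0 ?dprob_ge0. Qed.

Lemma base_trans_sum1 s : \sum_s' base_trans s s' = 1.
Proof.
rewrite exchange_big -[RHS](distr_sum1 (base_move s)); apply: eq_bigr => a _.
by rewrite -mulr_sumr distr_sum1 mulr1.
Qed.

(* When [visits s = 0], all the [x a] with [a \in Av s] vanish, whatever [base_move]. *)
Lemma visits_base_trans s s' :
  visits s * base_trans s s' = \sum_(a in Av s) x a * trans a s'.
Proof.
rewrite /base_trans /= /base_prob; case: (eqVneq (visits s) 0) => [v0|v0].
  rewrite v0 mul0r big1 // => a aAv.
  have /eqP := v0; rewrite psumr_eq0 => [/allP/(_ a)|a' _]; last exact: occ_x_ge0 occ a'.
  by rewrite mem_index_enum aAv => /(_ isT)/eqP ->; rewrite mul0r.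
rewrite mulr_sumr [RHS]big_mkcond; apply: eq_bigr => a _; case: ifP => _.
  by rewrite mulrA mulrCA divff // mulr1.
by rewrite mul0r mulr0.
Qed.

(** The actions are grouped by the unique state where they are available; those of the targets have
    [x a = 0]. *)
Lemma inflow_visits s' :
  \sum_a x a * trans a s' = \sum_(s | s \notin T) visits s * base_trans s s'.
Proof.
under [RHS]eq_bigr do rewrite visits_base_trans big_mkcond.
rewrite exchange_big; apply: eq_bigr => a _ /=.
have [s aAv] : exists s, a \in Av s.
  have /and3P[/eqP cov _ _] := Av_partition M.
  have : a \in finset.cover [set Av s | s in state M]%SET by rewrite cov finset.in_setT.
  by move=> /finset.bigcupP[_ /imsetP[s _ ->] aAv]; exists s.
have [sT|sT] := boolP (s \in T).
  rewrite (occ_x_T occ sT aAv) mul0r big1 // => s0 _.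
  by case: ifP => // _; rewrite mul0r.
rewrite (bigD1 s) //= aAv big1 ?addr0 // => s0 /andP[_ s0s].
by case: ifP => // aAv0; move: s0s; rewrite (Av_uniq aAv0 aAv) eqxx.
Qed.

(** With [keep_prob] this is the part of the two-memory flow that has not yet switched; with the
    constant 1 it is the memoryless flow. *)
Fixpoint killed_flow (keep : state M -> R) (k : nat) (s' : state M) : R :=
  keep s' * (if k is k'.+1 then
    \sum_(s | s \notin T) killed_flow keep k' s * base_trans s s'
  else (s' == init M)%:R).

Lemma killed_flow_ge0 keep k s : (forall s, 0 <= keep s) -> 0 <= killed_flow keep k s.
Proof.
move=> keep0; elim: k s => [|k IH] s' /=; rewrite mulr_ge0 //.
by apply: sumr_ge0 => s _; rewrite mulr_ge0 ?base_trans_ge0.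
Qed.

Lemma killed_flow_le keep keep' k s : (forall s, 0 <= keep s <= keep' s) ->
  killed_flow keep k s <= killed_flow keep' k s.
Proof.
move=> kk'; have k0 s0 : 0 <= keep s0 by have /andP[] := kk' s0.
have kle s0 : keep s0 <= keep' s0 by have /andP[] := kk' s0.
elim: k s => [|k IH] s' /=; apply: ler_pM => //.
  by apply: sumr_ge0 => s _; rewrite mulr_ge0 ?base_trans_ge0 ?killed_flow_ge0.
by apply: ler_sum => s _; rewrite ler_wpM2r ?base_trans_ge0.
Qed.

(** The mass entering [s] splits into the part [visits s] that goes on and the part [z s] that
    stops. The value 1 when [z s = 0] also covers states without any mass. *)
Definition keep_prob (s : state M) : R :=
  if z s == 0 then 1 else visits s / (visits s + z s).

Lemma keep_prob01 s : 0 <= keep_prob s <= 1.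
Proof.
rewrite /keep_prob; case: ifPn => [_|z0]; first by rewrite ler01 lexx.
have v0 := visits_ge0 s; have zs : 0 < z s by rewrite lt_def z0; exact: occ_z_ge0 occ s.
by rewrite divr_ge0 ?addr_ge0 ?(ltW zs) //= ler_pdivrMr ?mul1r ?lerDl ?(ltW zs) // ltr_wpDl.
Qed.

Lemma keep_prob_notU s : s \notin U -> keep_prob s = 1.
Proof. by move=> sU; rewrite /keep_prob (occ_z_U occ sU) eqxx. Qed.

Lemma keep_prob_visits s : keep_prob s * (visits s + z s) = visits s.
Proof.
rewrite /keep_prob; case: eqVneq => [->|z0]; first by rewrite mul1r addr0.
rewrite divfK // gt_eqF // ltr_wpDl // lt_def z0; exact: occ_z_ge0 occ s.
Qed.

(* The occupation measure [g n] of the first [n] steps increases to the least solution of the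
   flow equations, while [visits] is some solution. Their difference [w] loses at each step
   at least the mass by which the targets are missed, and this loss tends to 0. *)
Lemma killed_flow_cvg t : t \in T ->
  \sum_(k < n) killed_flow keep_prob k t @[n --> \oo] --> y t.
Proof.
move=> tT.
pose g n s := \sum_(k < n) killed_flow keep_prob k s.
pose w n s := visits s - g n s.
pose W n := \sum_(s | s \notin T) w n s.
have keepT t' : t' \in T -> keep_prob t' = 1.
  by move=> t'T; apply: keep_prob_notU; apply: contraL t'T; exact: occ_U_T occ t'.
have gS n s' : g n.+1 s' = keep_prob s' * ((s' == init M)%:R +
    \sum_(s | s \notin T) g n s * base_trans s s').
  rewrite /g big_ord_recl /= mulrDr; congr (_ + _).
  rewrite -mulr_sumr exchange_big; congr (_ * _); apply: eq_bigr => s _.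
  by rewrite mulr_suml.
have wS n s' : s' \notin T ->
    w n.+1 s' = keep_prob s' * \sum_(s | s \notin T) w n s * base_trans s s'.
  move=> s'T; rewrite /w gS -{1}(keep_prob_visits s') (occ_balance occ s'T) -mulrBr.
  congr (_ * _); rewrite inflow_visits opprD addrACA subrr add0r -sumrB.
  by apply: eq_bigr => s _; rewrite mulrBl.
have miss n t' : t' \in T -> y t' - g n.+1 t' = \sum_(s | s \notin T) w n s * base_trans s t'.
  move=> t'T; rewrite gS keepT // mul1r (occ_target occ t'T) inflow_visits.
  rewrite opprD addrACA subrr add0r -sumrB.
  by apply: eq_bigr => s _; rewrite mulrBl.
have w0 n s : s \notin T -> 0 <= w n s.
  elim: n s => [|n IH] s' s'T; first by rewrite /w /g big_ord0 subr0.
  have /andP[k0 _] := keep_prob01 s'.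
  rewrite wS // mulr_ge0 // sumr_ge0 // => s sT; by rewrite mulr_ge0 ?base_trans_ge0 ?IH.
have miss_ge0 n t' : t' \in T -> 0 <= y t' - g n.+1 t'.
  move=> t'T; rewrite miss // sumr_ge0 // => s sT; by rewrite mulr_ge0 ?base_trans_ge0 ?w0.
(* A step of [base_trans] conserves the mass [W n]: its part in [T] is what the targets miss, and
   the rest becomes [W n.+1] after multiplication by factors at most 1. *)
have loss n : \sum_(t' in T) (y t' - g n.+1 t') <= W n - W n.+1.
  rewrite lerBrDr.
  have -> : W n = \sum_s' \sum_(s | s \notin T) w n s * base_trans s s'.
    rewrite exchange_big; apply: eq_bigr => s _.
    by rewrite -mulr_sumr base_trans_sum1 mulr1.
  rewrite [leRHS](bigID (mem T)) /=; apply: lerD.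
    by apply: ler_sum => t' t'T; rewrite miss.
  apply: ler_sum => s' s'T; rewrite wS //.
  have /andP[_ k1] := keep_prob01 s'; rewrite ler_piMl // sumr_ge0 // => s sT.
  by rewrite mulr_ge0 ?base_trans_ge0 ?w0.
have miss_le n : 0 <= y t - g n.+1 t <= W n - W n.+1.
  rewrite miss_ge0 //=; apply: le_trans (loss n).
  by rewrite (bigD1 t) //= lerDl sumr_ge0 // => t' /andP[t'T _]; exact: miss_ge0.
(* Being nonincreasing and nonnegative, [W] converges, so its decrements tend to 0. *)
have W_cvg : cvgn W.
  apply: nonincreasing_is_cvgn; last first.
    by exists 0 => _ [n _ <-]; apply: sumr_ge0 => s sT; exact: w0.
  apply/nonincreasing_seqP => n; rewrite -subr_ge0.
  by have /andP[h1 h2] := miss_le n; exact: le_trans h1 h2.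
have Wdiff : (W n - W n.+1) @[n --> \oo] --> (0 : R).
  rewrite -(subrr (limn W)); apply: cvgB; first exact: W_cvg.
  by rewrite cvg_shiftS; exact: W_cvg.
have m0 : (y t - g n.+1 t) @[n --> \oo] --> (0 : R).
  by apply: (squeeze_cvgr _ (cvg_cst 0) Wdiff); apply: nearW => n; exact: miss_le.
rewrite -cvg_shiftS.
have -> : (fun n => \sum_(k < n.+1) killed_flow keep_prob k t) =
    (fun n => y t - (y t - g n.+1 t)).
  by apply/funext => n; rewrite subKr.
have h : (y t - (y t - g n.+1 t)) @[n --> \oo] --> y t - 0.
  by apply: cvgB => //; exact: cvg_cst.
by rewrite subr0 in h.
Qed.

Lemma trap_move_ex s : exists a, a \in Av s /\
  (s \in U -> forall s', 0 < trans a s' -> s' \in U).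
Proof.
have [sU|sU] := boolP (s \in U).
  by have [a aAv aU] := occ_U_trap occ sU; exists a.
by exists (xchoose (Av_neq0 s)); split=> //; exact: xchooseP.
Qed.

Definition trap_move (s : state M) : action M := sval (cid (trap_move_ex s)).

Lemma trap_move_Av s : trap_move s \in Av s.
Proof. by rewrite /trap_move; case: cid => a []. Qed.

Lemma trap_move_U s s' : s \in U -> s' \notin U -> trans (trap_move s) s' = 0.
Proof.
rewrite /trap_move; case: cid => a /= [_ aU] /aU{}aU s'U.
apply: le_anti; rewrite dprob_ge0 andbT leNgt; by apply: contra s'U; exact: aU.
Qed.

Definition two_memory_move (s : state M) (m : 'I_2) : distr R (action M) :=
  if m == ord0 then base_move s else point_distr R (trap_move s).

Lemma two_memory_move_Av s m a : 0 < two_memory_move s m a -> a \in Av s.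
Proof.
rewrite /two_memory_move; case: ifP => _; first exact: base_move_Av.
by rewrite /=; case: eqP => [-> _|_]; [exact: trap_move_Av|rewrite ltxx].
Qed.

(* Memory 0 follows the occupation measure; memory 1 stays in [U] for ever. *)
Definition two_memory : strategy M 'I_2 :=
  @Strategy R M 'I_2
    (fun _ s' m => if m == ord0 then coin_distr (keep_prob01 s') else point_distr R ord_max)
    two_memory_move (coin_distr (keep_prob01 (init M))) two_memory_move_Av.

Definition one_memory : strategy M 'I_1 :=
  @Strategy R M 'I_1 (fun _ _ _ => point_distr R ord0) (fun s _ => base_move s)
    (point_distr R ord0) (fun s _ => @base_move_Av s).

(** Memory 1 is entered only in [U], as [keep_prob] is 1 elsewhere, and its moves never leave [U];
    it therefore contributes nothing at the targets. *)
Lemma two_memory_flow1 k s m : m != ord0 -> s \notin U ->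
  memory_flow two_memory T k s m = 0.
Proof.
elim: k s m => [|k IH] s' m' m'0 s'U /=.
  rewrite (negbTE m'0); case: eqP => [<-|_]; last by rewrite mul0r.
  by rewrite keep_prob_notU // subrr mulr0.
rewrite big1 // => s sT; rewrite big1 // => m _.
case: (eqVneq m ord0) => [->|m0].
  rewrite big1 ?mulr0 // => a _ /=.
  by rewrite (negbTE m'0) keep_prob_notU // subrr mulr0.
have [sU|sU] := boolP (s \in U); last by rewrite IH // mul0r.
rewrite big1 ?mulr0 // => a _ /=; rewrite /two_memory_move (negbTE m0) /=.
by case: eqP => [->|_]; rewrite ?mul0r // trap_move_U // mulr0 mul0r.
Qed.

(** Memory 1 is never left, so memory 0 is fed only by itself, with the factor [keep_prob] at each
    arrival. *)
Lemma two_memory_flow0 k s :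
  memory_flow two_memory T k s ord0 = killed_flow keep_prob k s.
Proof.
elim: k s => [|k IH] s' /=.
  by rewrite mulrC; case: eqP => [->|_] //; rewrite !mulr0.
rewrite mulr_sumr; apply: eq_bigr => s sT.
rewrite !big_ord_recl big_ord0 /= addr0 IH mulrCA; rewrite [X in _ + _ * X]big1.
  rewrite mulr0 addr0; congr (_ * _); rewrite /base_trans mulr_sumr.
  by apply: eq_bigr => a _; rewrite mulrC.
by move=> a _; rewrite mulr0.
Qed.

Lemma one_memory_flow k s m :
  memory_flow one_memory T k s m = killed_flow (fun=> 1) k s.
Proof.
elim: k s m => [|k IH] s' m' /=; first by rewrite ord1 eqxx mulr1 mul1r.
rewrite mul1r; apply: eq_bigr => s sT; rewrite big_ord_recl big_ord0 addr0 IH.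
by congr (_ * _); apply: eq_bigr => a _; rewrite ord1 eqxx mulr1.
Qed.

Lemma two_memory_hit : exists2 P : probability (run M) R, induced_measure two_memory P &
  forall t, t \in T -> hit_prob T P t = y t.
Proof.
have [P indP arr] := finite_memory_run two_memory T; exists P => // t tT.
rewrite -(cvg_lim _ (hit_prob_cvg (P := P) tT)) //; apply: cvg_lim => //.
apply: cvg_trans (killed_flow_cvg tT); apply: near_eq_cvg; apply: nearW => n.
apply: eq_bigr => k _; rewrite arr (bigD1 ord0) //= two_memory_flow0 big1 ?addr0 //.
move=> m m0; apply: two_memory_flow1 => //; apply: contraL tT; exact: occ_U_T occ t.
Qed.

Lemma one_memory_hit : exists2 P : probability (run M) R, induced_measure one_memory P &
  forall t, t \in T -> y t <= hit_prob T P t.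
Proof.
have [P indP arr] := finite_memory_run one_memory T; exists P => // t tT.
apply: (ler_cvg_to (killed_flow_cvg tT) (hit_prob_cvg (P := P) tT)); apply: nearW => n.
apply: ler_sum => k _; rewrite arr big_ord_recl big_ord0 addr0 one_memory_flow.
by apply: killed_flow_le => s; exact: keep_prob01.
Qed.

End OccupationStrategies.

Lemma hit_prob_notin (R : realType) (M : mdp R) (P : probability (run M) R)
    (T : {set state M}) t : t \notin T -> hit_prob T P t = 0.
Proof.
move=> tT; rewrite /hit_prob (_ : hit T t = set0) /pr ?measure0 //.
by apply/seteqP; split=> // rho [n _ [tT']]; move: tT; rewrite tT'.
Qed.

Lemma run_occupation (R : realType) (M : mdp R) (T : {set state M})
    (Mem : countType) (sigma : strategy M Mem) (P : probability (run M) R) :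
  induced_measure sigma P -> exists U x z, occupation T U x z (hit_prob T P).
Proof.
move=> indP; apply: (@occupation_exists _ _ _ (arrive P T) (play P T)).
- by move=> k s; exact: arrive_ge0.
- by move=> k a; exact: play_ge0.
- exact: (arrive0 indP).
- exact: (arriveS indP).
- exact: (play_Av_T indP).
- exact: (arrive_play indP).
- exact: hit_prob_cvg.
Qed.

Theorem theorem6p3 (R : realType) (M : mdp R) (T : {set state M})
    (T_absorbing : absorbing T) (d : nat) (r : state M -> 'I_d -> rat) :
  memory_sufficient 2 T r /\
  ((forall s, s \in T -> forall j, (0 <= r s j)%R) -> memory_sufficient 1 T r).
Proof.
split=> [Q|r_ge0 Q] [Mem [sigma [P indP sat]]];
  have [U [x [z occ]]] := run_occupation T indP.
- have [P' indP' hitP'] := two_memory_hit occ; exists (two_memory occ).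
  apply: (satisfies_of_dominance indP' _ sat) => j f _.
  (* Equal hitting probabilities give dominance with equality. *)
  suff -> : hit_prob T P' = hit_prob T P by [].
  apply/funext => t; have [/hitP' //|tT] := boolP (t \in T).
  by rewrite !hit_prob_notin.
- have [P' indP' hitP'] := one_memory_hit occ; exists (one_memory occ).
  apply: (satisfies_of_dominance indP' _ sat) => j f f_homo.
  (* As the rewards are nonnegative and [f] is nondecreasing, the coefficient of each hitting
     probability is nonnegative. *)
  rewrite /fmean lerD2l; apply: ler_sum => t _.
  have [tT|tT] := boolP (t \in T); last by rewrite !hit_prob_notin.
  by rewrite ler_wpM2r ?hitP' // subr_ge0 f_homo // ler0q r_ge0.
Qed.
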